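(* For every $\alpha\in[0,1]$ there exist a sequence $\bar l=(l_i)_{i\ge 0}$ of integers $l_i\ge 5$, satisfying $\lim_{i\to\infty}\prod_{j=0}^{i}\frac{l_j-2}{l_j}=\alpha$ in case $\alpha\in(0,1)$, and a branch group $G_\alpha\le \operatorname{Aut}(T_{\bar l})$ such that $$\mathcal{L}_\alpha\cup\mathcal{L}\subseteq \operatorname{spec}_H^{fg}(G_\alpha),$$ where $$\mathcal{L}=\Big\{q\in[0,1]\cap\mathbb{Q} : \text{there exists a finite set } \{j_1,\dots,j_{r}\}\subset\mathbb{N}\text{ with } q\cdot\prod_{k=1}^{r}(l_{j_k}-2)\in\mathbb{Z}\Big\}$$ and $\mathcal{L}_\alpha=\{l\cdot\alpha : l\in\mathcal{L}\}$.
   Context: Here $\mathbb{N}=\{0,1,2,\dots\}$ is the index set of the sequence $(l_i)$. Trees. For a sequence $\bar l=(l_n)_{n\ge 0}$ of integers $l_n\ge 2$, $T_{\bar l}$ denotes the infinite spherically homogeneous rooted tree in which every vertex at distance $n$ from the root (level $n$) has exactly $l_n$ children; $\Omega(n)$ is the set of vertices of level $n$. $\operatorname{Aut}(T)$ is the group of root-preserving graph automorphisms of $T$. For a vertex $u$, $T_u$ is the subtree rooted at $u$ (consisting of $u$ and its descendants). Subgroups. For $G\le\operatorname{Aut}(T)$, the $n$-th level stabilizer is $\operatorname{St}_G(n)=\{g\in G: u^g=u \text{ for all } u\in\Omega(n)\}$. The rigid vertex stabilizer of $u$ is $\operatorname{rst}_G(u)=\{g\in G: v^g=v\text{ for all vertices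 } v\notin T_u\}$, and $\operatorname{rst}_G(n)=\prod_{u\in\Omega(n)}\operatorname{rst}_G(u)$ (an internal direct product in $G$). Branch groups. A subgroup $G\le\operatorname{Aut}(T_{\bar l})$ is a branch group if it acts transitively on every level $\Omega(n)$ and $\operatorname{rst}_G(n)$ has finite index in $G$ for every $n$. Hausdorff dimension and spectrum. The filtration $(\operatorname{St}_G(n))_{n\ge 0}$ of $G$ is used throughout. For $H\le G\le\operatorname{Aut}(T)$, $\dim_G(H)$ denotes the Hausdorff dimension of the closure of $H$ in the completion of $G$ with respect to the metric given by this filtration; equivalently $$\dim_G(H)=\liminf_{n\to\infty}\frac{\log|H/(H\cap \operatorname{St}_G(n))|}{\log|G/\operatorname{St}_G(n)|}.$$ The finitely generated Hausdorff spectrum of $G$ is $\operatorname{spec}_H^{fg}(G)=\{\dim_G(H) : H\le G,\ H\text{ finitely generated}\}$. *)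

(* Defs.v *)
From HB Require Import structures.
From mathcomp Require Import all_boot all_order all_algebra finmap.
From mathcomp Require Import all_classical all_reals all_analysis.

Set Implicit Arguments.
Unset Strict Implicit.
Unset Printing Implicit Defensive.

Import Order.TTheory GRing.Theory Num.Theory.
Import numFieldNormedType.Exports.

Local Open Scope classical_set_scope.
Local Open Scope ring_scope.

Section Subgroups.
Variable gT : groupType.
Implicit Types (x : gT) (A S H K : set gT).
Local Open Scope group_scope.

Definition subgroup H : Prop := group_closed [in H].

Definition generated A : set gT := smallest subgroup A.

Definition finitely_generated H : Prop :=
  exists2 A, finite_set A & H = generated A.

Definition left_coset x K : set gT := [set x * k | k in K].

Definition left_cosets H K : set (set gT) := [set left_coset x K | x in H].

Definition finite_index H K : Prop := finite_set (left_cosets H K).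

(* The index [|H : K|]; its value is [0] when the index is infinite. *)
Definition index H K : nat := #|` fset_set (left_cosets H K)|.

End Subgroups.

Section Trees.
Variable l : nat -> nat.

(* A vertex is the sequence of choices made along the path from the root:
   the [i]-th entry selects one of the [l i] children of a vertex of level [i]. *)
Definition is_vertex (s : seq nat) : bool :=
  [forall i : 'I_(size s), nth 0%N s i < l i]%N.

Definition vertex : Type := {s : seq nat | is_vertex s}.

HB.instance Definition _ := Choice.on vertex.

Fact is_vertex_nil : is_vertex [::].
Proof. by apply/forallP => -[]. Qed.

Definition root : vertex := exist _ [::] is_vertex_nil.

Definition level (n : nat) : set vertex := [set u | size (val u) = n].

Definition subtree (u : vertex) : set vertex :=
  [set v | prefix (val u) (val v)].

Definition child (u v : vertex) : bool :=
  prefix (val u) (val v) && (size (val v) == (size (val u)).+1).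

Definition adjacent (u v : vertex) : bool := child u v || child v u.

Definition is_automorphism (f : vertex -> vertex) : Prop :=
  [/\ bijective f, f root = root &
      forall u v, adjacent (f u) (f v) = adjacent u v].

Record tree_aut := TreeAut {
  tree_aut_fun :> vertex -> vertex;
  _ : `[< is_automorphism tree_aut_fun >] }.

HB.instance Definition _ := [isSub for tree_aut_fun].
HB.instance Definition _ := [Choice of tree_aut by <:].

Lemma tree_autP (f : tree_aut) : is_automorphism f.
Proof. by case: f => f /= /asboolP. Qed.

Fact tree_aut_id : `[< is_automorphism id >].
Proof. by apply/asboolP; split=> //; exists id. Qed.

Fact tree_aut_comp (f g : tree_aut) : `[< is_automorphism (g \o f) >].
Proof.
apply/asboolP; have [fb fr fa] := tree_autP f; have [gb gr ga] := tree_autP g.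
split=> [||u v]; first exact: bij_comp.
- by rewrite /= fr.
- by rewrite /= ga fa.
Qed.

Fact tree_aut_surj (f : tree_aut) (v : vertex) : exists u, f u == v.
Proof. by have [[g _ gK] _ _] := tree_autP f; exists (g v); rewrite gK. Qed.

Definition tree_aut_finv (f : tree_aut) (v : vertex) : vertex :=
  xchoose (tree_aut_surj f v).

Fact tree_aut_finvK (f : tree_aut) : cancel (tree_aut_finv f) f.
Proof. by move=> v; apply/eqP; exact: xchooseP (tree_aut_surj f v). Qed.

Fact tree_autK (f : tree_aut) : cancel f (tree_aut_finv f).
Proof.
have [fb _ _] := tree_autP f.
by move=> u; apply: (bij_inj fb); rewrite tree_aut_finvK.
Qed.

Fact tree_aut_finv_subproof (f : tree_aut) :
  `[< is_automorphism (tree_aut_finv f) >].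
Proof.
apply/asboolP; have [fb fr fa] := tree_autP f; split=> [||u v].
- exact: Bijective (@tree_aut_finvK f) (@tree_autK f).
- by rewrite -[in LHS]fr tree_autK.
- by rewrite -fa !tree_aut_finvK.
Qed.

(* Automorphisms act on the right, so the product [g * h] applies [g] first. *)
Definition tree_aut_one : tree_aut := TreeAut tree_aut_id.
Definition tree_aut_mul (g h : tree_aut) : tree_aut :=
  TreeAut (tree_aut_comp g h).
Definition tree_aut_inv (g : tree_aut) : tree_aut :=
  TreeAut (tree_aut_finv_subproof g).

Fact tree_aut_mulA : associative tree_aut_mul.
Proof. by move=> f g h; exact: val_inj. Qed.

Fact tree_aut_mul1 : left_id tree_aut_one tree_aut_mul.
Proof. by move=> f; exact: val_inj. Qed.

Fact tree_aut_mulr1 : right_id tree_aut_one tree_aut_mul.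
Proof. by move=> f; exact: val_inj. Qed.

Fact tree_aut_mulV : left_inverse tree_aut_one tree_aut_inv tree_aut_mul.
Proof. by move=> f; apply/val_inj/funext => u; exact: tree_aut_finvK. Qed.

Fact tree_aut_mulrV : right_inverse tree_aut_one tree_aut_inv tree_aut_mul.
Proof. by move=> f; apply/val_inj/funext => u; exact: tree_autK. Qed.

HB.instance Definition _ := isGroup.Build tree_aut
  tree_aut_mulA tree_aut_mul1 tree_aut_mulr1 tree_aut_mulV tree_aut_mulrV.

Implicit Types (G H : set tree_aut) (u v : vertex) (n : nat).

Definition level_stabilizer G n : set tree_aut :=
  [set g | G g /\ forall u, level n u -> g u = u].

Definition rigid_vertex_stabilizer G u : set tree_aut :=
  [set g | G g /\ forall v, ~ subtree u v -> g v = v].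

(* The internal direct product of the [rst_G(u)], [u] of level [n]: these
   subgroups commute pairwise and their product is the subgroup they generate. *)
Definition rigid_level_stabilizer G n : set tree_aut :=
  generated (\bigcup_(u in level n) rigid_vertex_stabilizer G u).

Definition level_transitive G : Prop :=
  forall n u v, level n u -> level n v -> exists2 g, G g & g u = v.

Definition branch_group G : Prop :=
  [/\ subgroup G, level_transitive G &
      forall n, finite_index G (rigid_level_stabilizer G n)].

Variable R : realType.

(* The Hausdorff dimension of the closure of [H] in the completion of [G] for
   the filtration [(St_G(n))_n], by the Barnea-Shalev formula. The term [n = 0]
   is [0 / 0], which is [0] here and does not affect the limit inferior. *)
Definition hausdorff_dim G H : \bar R :=
  limn_einf (fun n =>
    (ln (index H (H `&` level_stabilizer G n))%:R /
     ln (index G (level_stabilizer G n))%:R)%:E).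

Definition fg_hausdorff_spectrum G : set R :=
  [set x | exists H, [/\ subgroup H, H `<=` G, finitely_generated H &
                         hausdorff_dim G H = x%:E]].

End Trees.

(* [\mathcal{L}]; the index set may be enlarged freely, so allowing the empty one
   changes nothing. *)
Definition spectrum_rationals (R : realType) (l : nat -> nat) : set R :=
  [set ratr q | q in [set q : rat | 0 <= q <= 1 /\
     exists J : {fset nat}, q * \prod_(j <- J) ((l j)%:R - 2) \is a Num.int]].

(* [\mathcal{L}_\alpha] *)
Definition scaled_spectrum_rationals (R : realType) (l : nat -> nat)
    (alpha : R) : set R :=
  [set x * alpha | x in spectrum_rationals l].

(* Main.v *)
(* Take G = Aut(T) with degrees l_i -> oo chosen greedily so that the products
   of the (l_j - 2) / l_j tend to alpha. Every x in [0, 1] is then the dimension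
   of a finitely generated subgroup. For x > 0 choose 5 <= m_i <= l_i such that
   the products of the m_j / l_j tend to x, so that T_l contains a copy of T_m.
   Two generators of Alt(m_0) acting at the root, together with two elements
   that act, for all j, at the vertex 0^j 1 by generators of Alt(m_(j+1)),
   generate a group H containing a copy of Alt(m_k) at each vertex of level k of
   T_m: a commutator of one directed element with a conjugate of the other is
   concentrated at a single vertex, and Alt is perfect. With
   M_k = m_0 ... m_(k-1), the logarithm of the order of H on level n therefore
   lies between the sums over k < n of M_k log(m_k! / 2) and of M_k log(m_k!),
   and likewise for G and l. As log(m!) / log(l!) -> 1 when m / l -> 1, the
   dimension of H is the limit of the products of the m_j / l_j. *)
Require Import Defs.
From mathcomp Require Import all_boot all_order all_algebra finmap.
From mathcomp Require Import all_fingroup all_solvable.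
From mathcomp Require Import all_classical all_reals all_analysis.
From mathcomp Require Import zify ring lra.

Set Implicit Arguments.
Unset Strict Implicit.
Unset Printing Implicit Defensive.

Import Order.TTheory GRing.Theory Num.Theory.
Import numFieldNormedType.Exports.

(** * Alternating groups *)

Section Alternating.
Local Open Scope group_scope.

Lemma Alt_two_generated n : (1 < n)%N ->
  exists a b : {perm 'I_n}, 'Alt_('I_n) = <<[set a; b]>>.
Proof.
case: n => [|[|n]] // _.
pose t : {perm 'I_n.+2} := tperm 0%R 1%R.
pose s : {perm 'I_n.+2} := perm (GRing.addrI (1%R : 'Z_n.+2)).
have genS : <<[set t; s]>> = [set: {perm 'I_n.+2}].
  by apply: gen_tpermn_circular_shift; rewrite GRing.subr0 coprimen1.
have odd_t : odd_perm t by rewrite odd_tperm.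
have tK : t * t = 1 by exact: tperm2.
have tV : t^-1 = t by rewrite tpermV.
(* [a] and [b] are the Schreier generators of the subgroup of index 2 of
   [<<[set t; s]>>] for the transversal [1, t]. *)
pose a := if odd_perm s then s * t else s.
pose b := if odd_perm s then t * s else t * s * t.
exists a, b; set K := <<_>>.
have aK : a \in K by rewrite mem_gen // !inE eqxx.
have bK : b \in K by rewrite mem_gen // !inE eqxx orbT.
have sKA : K \subset 'Alt_('I_n.+2).
  rewrite gen_subG; apply/fintype.subsetP => x /set2P[] ->.
    by rewrite Alt_even /a; case: ifPn => // os; rewrite odd_permM os odd_t.
  rewrite Alt_even /b; case: ifPn => os; rewrite !odd_permM odd_t ?os //.
  by rewrite (negPf os).
have atE : a ^ t = b.
  by rewrite conjgE tV /a /b; case: ifP => _; rewrite -!mulgA ?tK ?mulg1.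
have btE : b ^ t = a by rewrite -atE -conjgM tK conjg1.
have nKt : t \in 'N(K).
  rewrite inE -genJ gen_subG; apply/fintype.subsetP => x /imsetP[y].
  by move=> /set2P[] -> ->; rewrite ?atE ?btE.
have nKs : s \in 'N(K).
  have -> : s = if odd_perm s then a * t else a.
    by rewrite /a; case: (odd_perm s); rewrite // -mulgA tK mulg1.
  by case: ifP => _; rewrite ?groupM // (fintype.subsetP (normG _)).
(* Since [t] normalizes [K], the product [K * <[t]>] is a group, and it contains both generators of
   the symmetric group. An even element [k * t ^+ i] then has [i] even, so it lies in [K]. *)
have sT : [set: {perm 'I_n.+2}] \subset K * <[t]>.
  rewrite -genS -norm_joinEr ?cycle_subG // gen_subG.
  apply/fintype.subsetP => x /set2P[] ->.
    by rewrite (fintype.subsetP (joing_subr _ _)) ?cycle_id.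
  have -> : s = if odd_perm s then a * t else a.
    by rewrite /a; case: (odd_perm s); rewrite // -mulgA tK mulg1.
  have aJ : a \in K <*> <[t]> by rewrite (fintype.subsetP (joing_subl _ _)).
  by case: ifP => // _; rewrite groupM // (fintype.subsetP (joing_subr _ _)) ?cycle_id.
apply/eqP; rewrite finset.eqEsubset sKA andbT; apply/fintype.subsetP => x.
rewrite Alt_even => even_x.
have /imset2P[k u kK /cycleP[i ->] xE] := fintype.subsetP sT x (finset.in_setT x).
have even_k : ~~ odd_perm k by rewrite -Alt_even (fintype.subsetP sKA).
rewrite xE; suff -> : t ^+ i = 1 by rewrite mulg1.
have tE : t ^+ i = t ^+ odd i.
  rewrite -{1}(odd_double_half i) expgD -mul2n expgM.
  by rewrite expgS expg1 tK expg1n mulg1.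
move: even_x; rewrite xE odd_permM (negPf even_k) /= tE.
by case: (odd i) => //; rewrite expg1 odd_t.
Qed.

(** On at least five letters Alt is simple and not solvable, so its derived subgroup cannot be
    trivial. *)
Lemma der1_Alt (T : finType) : (4 < #|T|)%N -> ('Alt_T)^`(1)%g = 'Alt_T.
Proof.
move=> cT; have /simpleP[nA1 sA] := simple_Alt5 cT.
have [d1|//] := sA _ (der_normal 1 'Alt_T).
have := solvable_AltF cT; rewrite abelian_sol //.
by apply/commG1P; rewrite -derg1.
Qed.

(** The transposition of [x] and [y] is made even by a transposition of two further letters, hence
    the four letters. *)
Lemma Alt_transitive (T : finType) (x y : T) : (3 < #|T|)%N ->
  exists2 s, s \in 'Alt_T & s x = y.
Proof.
move=> cT; have [<-|nxy] := eqVneq x y; first by exists 1; rewrite ?group1 ?perm1.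
have : (1 < #|[set~ x] :\ y|)%N.
  have := cardsD1 y [set~ x]; rewrite !inE eq_sym nxy cardsC1 add1n => cE.
  by rewrite -ltnS -cE -ltnS prednK //; apply: ltn_trans cT.
case/card_gt1P => z [w] [zE wE nzw].
move: zE wE; rewrite !inE => /andP[zy zx] /andP[wy wx].
exists (tperm x y * tperm z w).
  by rewrite Alt_even odd_permM !odd_tperm nxy nzw.
by rewrite permM tpermL tpermD // eq_sym.
Qed.

End Alternating.

(** * Tree automorphisms as maps on words *)

Section Vertices.
Variable l : nat -> nat.
Implicit Types (s t u : seq nat).

Lemma is_vertexP s :
  reflect (forall i, (i < size s)%N -> (nth 0%N s i < l i)%N) (is_vertex l s).
Proof.
apply: (iffP forallP) => h i; last exact: h.
by move=> is_; apply: (h (Ordinal is_)).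
Qed.

Lemma is_vertex_rcons s x :
  is_vertex l (rcons s x) = is_vertex l s && (x < l (size s))%N.
Proof.
apply/is_vertexP/andP => [h|[/is_vertexP h xl] i].
  split; last by have := h (size s); rewrite size_rcons nth_rcons ltnn eqxx; apply.
  apply/is_vertexP => i is_; have := h i.
  by rewrite size_rcons nth_rcons is_; apply; apply: ltnW.
rewrite size_rcons ltnS leq_eqVlt nth_rcons => /predU1P[->|is_].
  by rewrite ltnn eqxx.
by rewrite is_ h.
Qed.

Lemma is_vertex_prefix s t : prefix s t -> is_vertex l t -> is_vertex l s.
Proof.
move=> /prefixP[r ->]; elim/last_ind: r => [|r x IH]; first by rewrite cats0.
by rewrite -rcons_cat is_vertex_rcons => /andP[/IH].
Qed.

Definition Vertex s (sl : is_vertex l s) : vertex l := exist _ s sl.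

End Vertices.

Section TreeAction.
Variable l : nat -> nat.
Implicit Types (s t : seq nat) (g h : tree_aut l) (u v : vertex l).

(** Plain words replace the dependent type of vertices. Off the tree the action is the identity, so
    [app g] is a bijection on all words. *)
Definition app g s : seq nat :=
  oapp (fun v : vertex l => val (g v)) s (insub s).

Lemma appE g v : app g (val v) = val (g v).
Proof. by rewrite /app valK. Qed.

Lemma app_out g s : ~~ is_vertex l s -> app g s = s.
Proof. by move=> sl; rewrite /app insubN. Qed.

Lemma is_vertex_app g s : is_vertex l (app g s) = is_vertex l s.
Proof.
have [sl|sl] := boolP (is_vertex l s); last by rewrite app_out // (negPf sl).
by rewrite -[s]/(val (Vertex sl)) appE; apply: valP.
Qed.

Lemma app_mul g h s : app (g * h)%g s = app h (app g s).
Proof.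
have [sl|sl] := boolP (is_vertex l s); last by rewrite !app_out.
by rewrite -[s]/(val (Vertex sl)) !appE.
Qed.

Lemma app1 s : app 1%g s = s.
Proof.
have [sl|sl] := boolP (is_vertex l s); last by rewrite !app_out.
by rewrite -[s]/(val (Vertex sl)) !appE.
Qed.

Lemma appK g : cancel (app g) (app g^-1%g).
Proof. by move=> s; rewrite -app_mul mulgV app1. Qed.

Lemma appVK g : cancel (app g^-1%g) (app g).
Proof. by move=> s; rewrite -app_mul mulVg app1. Qed.

Lemma app_inj g : injective (app g).
Proof. exact: can_inj (appK g). Qed.

Lemma app_ext g h : (forall s, is_vertex l s -> app g s = app h s) -> g = h.
Proof.
move=> gh; apply/val_inj/funext => v; apply: val_inj.
by rewrite -!appE gh //; apply: valP.
Qed.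

(** By induction on the level. The image of an edge from [u] down to [v] can be reversed only if
    [g v] is the parent of [g u]; that parent is already the image of the parent of [u]. *)
Lemma child_aut g n v : size (val v) = n ->
  size (val (g v)) = n /\ (forall u, child u v -> child (g u) (g v)).
Proof.
have [gb groot gadj] := tree_autP g.
elim: n v => [|n IH] v sv.
  have -> : v = Defs.root l by apply: val_inj; apply: size0nil.
  by rewrite groot; split=> // u /andP[_ /=].
have chE u : child u v -> child (g u) (g v).
  move=> uv; have /andP[_ /eqP] := uv; rewrite sv => -[su].
  have [sgu gchild] := IH u (esym su).
  have := gadj u v; rewrite /Defs.adjacent uv orTb => /orP[//|/andP[pvu /eqP]].
  rewrite sgu => nE.
  have [w wu sw] : exists2 w : vertex l, child w u & size (val w) = n.-1.
    have ul : is_vertex l (take n.-1 (val u)).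
      by apply: is_vertex_prefix (valP u); apply: prefix_take.
    exists (Vertex ul); last by rewrite /= size_take -su nE /= ltnSn.
    by rewrite /child /= prefix_take size_take -su nE /= ltnSn.
  have /andP[pwu /eqP] := gchild _ wu; rewrite sgu nE => -[sgw].
  have gE : g w = g v.
    apply: val_inj; move: pwu pvu; rewrite !prefixE sgw => /eqP {1}<- /eqP {1}<-.
    by [].
  by move: sv; rewrite -(bij_inj gb gE) sw nE; lia.
split=> //.
have ul : is_vertex l (take n (val v)).
  by apply: is_vertex_prefix (valP v); apply: prefix_take.
have wv : child (Vertex ul) v.
  apply/andP; split; first exact: prefix_take.
  by rewrite /= size_take sv ltnSn.
have /andP[_ /eqP->] := chE _ wv; congr S.
have sw : size (val (Vertex ul)) = n by rewrite /= size_take sv ltnSn.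
by have [-> _] := IH _ sw.
Qed.

Lemma size_app g s : size (app g s) = size s.
Proof.
have [sl|sl] := boolP (is_vertex l s); last by rewrite app_out.
rewrite -[s]/(val (Vertex sl)) appE.
by have [] := child_aut g (erefl (size (val (Vertex sl)))).
Qed.

Lemma prefix_app g s t :
  is_vertex l t -> prefix s t -> prefix (app g s) (app g t).
Proof.
move=> tl /prefixP[r tE]; move: tl; rewrite {t}tE.
elim/last_ind: r => [|r x IH]; first by rewrite cats0 prefix_refl.
rewrite -rcons_cat; set t := s ++ r => tl.
have tl' : is_vertex l t by apply: is_vertex_prefix tl; apply: prefix_rcons.
apply: prefix_trans (IH tl') _.
have [_ h] := child_aut g (erefl (size (val (Vertex tl)))).
have ch : child (Vertex tl') (Vertex tl).
  by rewrite /child /= prefix_rcons size_rcons eqxx.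
by have /andP[+ _] := h _ ch; rewrite -!appE.
Qed.

Lemma prefix_appE g s t :
  is_vertex l t -> prefix (app g s) (app g t) = prefix s t.
Proof.
move=> tl; apply/idP/idP; last exact: prefix_app.
by rewrite -{2}[s](appK g) -{2}[t](appK g); apply: prefix_app; rewrite is_vertex_app.
Qed.

Definition tree_map (f : seq nat -> seq nat) : Prop :=
  [/\ forall s, size (f s) = size s,
      forall s t, is_vertex l t -> prefix s t -> prefix (f s) (f t) &
      forall s, is_vertex l s -> is_vertex l (f s)].

Lemma tree_aut_of_map f f' : tree_map f -> tree_map f' ->
  (forall s, is_vertex l s -> f' (f s) = s) ->
  (forall s, is_vertex l s -> f (f' s) = s) ->
  exists g : tree_aut l, forall s, is_vertex l s -> app g s = f s.
Proof.
move=> [sf pf vf] [sf' pf' vf'] fK f'K.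
pose F (v : vertex l) : vertex l := Vertex (vf _ (valP v)).
pose F' (v : vertex l) : vertex l := Vertex (vf' _ (valP v)).
have FK : cancel F F' by move=> v; apply: val_inj; apply: fK (valP v).
have F'K : cancel F' F by move=> v; apply: val_inj; apply: f'K (valP v).
have chF u v : child (F u) (F v) = child u v.
  rewrite /child /= !sf; congr (_ && _); apply/idP/idP; last exact: pf (valP v).
  move=> /(pf' _ _ (vf _ (valP v))); rewrite !fK //; exact: valP.
have Faut : `[< is_automorphism F >].
  apply/asboolP; split; first by exists F'.
    by apply: val_inj; apply: size0nil; rewrite /= sf.
  by move=> u v; rewrite /Defs.adjacent !chF.
exists (TreeAut Faut) => s sl.
by rewrite -[s]/(val (Vertex sl)) appE.
Qed.

End TreeAction.

(** * Directed automorphisms *)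

Section Letters.
Variable n : nat.
Implicit Types (p q : 'S_n) (x : nat).

(** Letters from [n] on are fixed, so a permutation of [m k] letters also acts on the [l k] children
    of a vertex of the larger tree. *)
Definition pnat p x : nat := oapp (fun i => val (p i)) x (insub x).

Lemma pnatE p (i : 'I_n) : pnat p i = p i.
Proof. by rewrite /pnat valK. Qed.

Lemma pnat_out p x : (n <= x)%N -> pnat p x = x.
Proof. by move=> nx; rewrite /pnat insubN // -leqNgt. Qed.

Lemma pnat_lt p x : (pnat p x < n)%N = (x < n)%N.
Proof.
case: (ltnP x n) => [xn|nx]; last by rewrite pnat_out // ltnNge nx.
by rewrite -[x]/(val (Ordinal xn)) pnatE ltn_ord.
Qed.

Lemma pnatM p q x : pnat (p * q)%g x = pnat q (pnat p x).
Proof.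
case: (ltnP x n) => [xn|nx]; last by rewrite !pnat_out.
by rewrite -[x]/(val (Ordinal xn)) !pnatE permM.
Qed.

Lemma pnat1 x : pnat 1%g x = x.
Proof.
case: (ltnP x n) => [xn|nx]; last by rewrite !pnat_out.
by rewrite -[x]/(val (Ordinal xn)) !pnatE perm1.
Qed.

End Letters.

Section Portraits.
Variable m : nat -> nat.
Notation family := (forall k, 'S_(m k)).
Implicit Types (A B : pred (seq nat)) (g h : family) (s t u v : seq nat).

(* Reads the word [s] placed at level [i] and lets [g] act on the letter that
   follows its shortest prefix in [A]. *)
Fixpoint act A g i s : seq nat :=
  if s is x :: s' then
    if A [::] then pnat (g i) x :: s'
    else x :: act (fun u => A (x :: u)) g i.+1 s'
  else [::].

Lemma size_act A g i s : size (act A g i s) = size s.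
Proof. by elim: s A i => //= x s IH A i; case: ifP => //= _; rewrite IH. Qed.

Lemma act_eq A B g i s : A =1 B -> act A g i s = act B g i s.
Proof.
elim: s A B i => //= x s IH A B i AB; rewrite AB; case: ifP => // _.
by congr (_ :: _); apply: IH => u; apply: AB.
Qed.

Lemma act_mul A g h i s :
  act A (fun k => g k * h k)%g i s = act A h i (act A g i s).
Proof.
elim: s A i => //= x s IH A i; case: ifP => /= ->; first by rewrite pnatM.
by rewrite IH.
Qed.

Lemma act1 A i s : act A (fun=> 1%g) i s = s.
Proof.
elim: s A i => //= x s IH A i; case: ifP => _; first by rewrite pnat1.
by rewrite IH.
Qed.

Lemma act_out A g i s : (forall u, A u -> ~~ prefix u s) -> act A g i s = s.
Proof.
elim: s A i => // x s IH A i As /=; case: ifPn => [/As|_]; first by rewrite prefix0s.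
by congr (_ :: _); apply: IH => u /As; rewrite prefix_cons eqxx.
Qed.

(** When the two sets are prefix-incomparable, at most one of them has a member on the path of
    [s]. *)
Lemma actU A B g i s :
  (forall u v, A u -> B v -> ~~ prefix u v && ~~ prefix v u) ->
  act (predU A B) g i s = act B g i (act A g i s).
Proof.
elim: s A B i => // x s IH A B i AB /=; have [A0|A0] /= := boolP (A [::]).
  case: ifPn => [B0|_]; first by have := AB _ _ A0 B0.
  by rewrite act_out // => u Bu; have := AB _ _ A0 Bu; rewrite prefix0s.
case: ifPn => [B0|_].
  rewrite act_out // => u Au; have /andP[_] := AB _ _ Au B0.
  by rewrite prefix0s.
congr (_ :: _); apply: IH => u v Au Bv.
by have := AB _ _ Au Bv; rewrite !prefix_cons eqxx.
Qed.

Lemma act_prefix A g i s t : prefix s t -> prefix (act A g i s) (act A g i t).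
Proof.
elim: s A i t => [|x s IH] A i [|y t] //; first by move=> _; exact: prefix0s.
rewrite prefix_cons => /andP[/eqP<- st].
by rewrite /act -/act; case: ifP => _; rewrite prefix_cons eqxx ?IH.
Qed.

Lemma act_at v g i x s :
  act (pred1 v) g i (v ++ x :: s) = v ++ pnat (g (i + size v)%N) x :: s.
Proof.
elim: v i => [|y v IH] i /=; first by rewrite addn0.
rewrite addnS -addSn -IH; congr (_ :: _); apply: act_eq => u.
by rewrite /= eqseq_cons eqxx.
Qed.

Lemma act_self v g i : act (pred1 v) g i v = v.
Proof.
elim: v i => //= y v IH i; rewrite -[in RHS](IH i.+1).
by congr (_ :: _); apply: act_eq => u /=; rewrite eqseq_cons eqxx.
Qed.

Variable l : nat -> nat.
Hypothesis le_ml : forall k, (m k <= l k)%N.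

Lemma act_vertex A g s : is_vertex l s -> is_vertex l (act A g 0 s).
Proof.
move=> /is_vertexP sl; apply/is_vertexP => j; rewrite size_act => js.
suff act_lt i k : (nth 0%N s k < l (i + k))%N ->
    (nth 0%N (act A g i s) k < l (i + k))%N by apply: (act_lt 0%N); exact: sl.
elim: s A i k {j sl js} => // x s IH A i [|k] /=.
  rewrite addn0; case: ifP => //= _ xl.
  case: (ltnP x (m i)) => [xm|mx]; last by rewrite pnat_out.
  by apply: leq_trans (le_ml i); rewrite pnat_lt.
by rewrite addnS -addSn; case: ifP => _; [|apply: IH].
Qed.

Lemma act_tree_map A g : tree_map l (act A g 0).
Proof.
split=> [s|s t _|s]; [exact: size_act|exact: act_prefix|exact: act_vertex].
Qed.

Lemma actV A g i s : act A (fun k => (g k)^-1)%g i (act A g i s) = s.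
Proof.
rewrite -act_mul -[RHS](act1 A i); congr act.
by apply: functional_extensionality_dep => k; rewrite mulgV.
Qed.

Lemma actVr A g i s : act A g i (act A (fun k => (g k)^-1)%g i s) = s.
Proof.
rewrite -act_mul -[RHS](act1 A i); congr act.
by apply: functional_extensionality_dep => k; rewrite mulVg.
Qed.

Definition aut A g : tree_aut l :=
  projT1 (cid (tree_aut_of_map (act_tree_map A g)
    (act_tree_map A (fun k => (g k)^-1)%g)
    (fun s _ => actV A g 0 s) (fun s _ => actVr A g 0 s))).

Lemma app_aut A g s : is_vertex l s -> app (aut A g) s = act A g 0 s.
Proof. by move=> sl; rewrite /aut; case: cid => h /= ->. Qed.

Lemma autM A g h : aut A (fun k => g k * h k)%g = (aut A g * aut A h)%g.
Proof.
by apply: app_ext => s sl; rewrite app_mul !app_aut ?act_vertex // act_mul.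
Qed.

Lemma aut1 A : aut A (fun=> 1%g) = 1%g.
Proof. by apply: app_ext => s sl; rewrite app_aut // act1 app1. Qed.

Lemma autV A g : aut A (fun k => (g k)^-1)%g = ((aut A g)^-1)%g.
Proof.
apply: app_ext => s sl; rewrite app_aut //; apply: (@app_inj _ (aut A g)).
by rewrite appVK app_aut ?act_vertex // actVr.
Qed.

Lemma app_aut_out A g s : (forall u, A u -> ~~ prefix u s) -> app (aut A g) s = s.
Proof.
move=> As; have [sl|sl] := boolP (is_vertex l s); last exact: app_out.
by rewrite app_aut // act_out.
Qed.

(** The family enters only through [g (size v)]; passing all of it avoids a type that depends on the
    length of [v]. *)
Definition local v g := aut (pred1 v) g.

Lemma app_local v g x s : is_vertex l (v ++ x :: s) ->
  app (local v g) (v ++ x :: s) = v ++ pnat (g (size v)) x :: s.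
Proof. by move=> vl; rewrite app_aut // act_at. Qed.

Lemma app_local_self v g : app (local v g) v = v.
Proof.
have [sl|sl] := boolP (is_vertex l v); last exact: app_out.
by rewrite app_aut // act_self.
Qed.

Lemma app_local_out v g s : ~~ prefix v s -> app (local v g) s = s.
Proof. by move=> vs; apply: app_aut_out => u /eqP->. Qed.

Lemma local_eq v g h : g (size v) = h (size v) -> local v g = local v h.
Proof.
move=> gh; apply: app_ext => s sl; have [/prefixP[[|x t] sE]|vs] := boolP (prefix v s).
- by rewrite sE cats0 !app_local_self.
- by move: sl; rewrite sE => sl; rewrite !app_local // gh.
- by rewrite !app_local_out.
Qed.

(** A conjugator that merely replaces the prefix [v] by [w] carries the action below [v] unchanged
    to [w]. *)
Lemma local_conj v w g (z : tree_aut l) : is_vertex l v ->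
    (forall s, is_vertex l (v ++ s) -> app z (v ++ s) = w ++ s) ->
  ((local v g) ^ z)%g = local w g.
Proof.
move=> vl zE; have zv : app z v = w by rewrite -[v]cats0 zE ?cats0.
have szw : size w = size v by rewrite -zv size_app.
apply: (mulgI z); rewrite conjgE mulgA mulgV mul1g.
apply: app_ext => s sl; rewrite !app_mul.
have [/prefixP[[|x t] sE]|vs] := boolP (prefix v s).
- by rewrite sE cats0 app_local_self zv app_local_self.
- move: sl; rewrite sE => sl; rewrite app_local // !zE //; last first.
    by have := is_vertex_app (local v g) (v ++ x :: t); rewrite app_local // sl.
  by rewrite app_local ?szw // -zE // is_vertex_app.
- rewrite (app_local_out _ vs) app_local_out // -zv prefix_appE //.
Qed.

Definition spine k : seq nat := rcons (nseq k 0%N) 1%N.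

(** The vertices [spine j] with [j >= k]. As [spine j] has level [j.+1], [directed k g] acts there
    by [g j.+1]. *)
Definition above k : pred (seq nat) :=
  fun u => (k < size u)%N && (u == spine (size u).-1).

Definition directed k g := aut (above k) g.

Lemma size_spine k : size (spine k) = k.+1.
Proof. by rewrite size_rcons size_nseq. Qed.

Lemma prefix_spine j k : prefix (spine j) (spine k) -> j = k.
Proof.
rewrite prefixE size_spine => /eqP E.
have jk : (j < k.+1)%N.
  by have := congr1 size E; rewrite size_take !size_spine; case: ifP; lia.
have := congr1 (fun s => nth 0%N s j) E.
rewrite nth_take // !nth_rcons !size_nseq ltnn eqxx nth_nseq.
by case: ltnP => // kj _; lia.
Qed.

(** Spine vertices are pairwise incomparable, so the first one splits off as a factor; what remains
    is supported below the word of [k.+1] zeros. *)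
Lemma directedE k g : directed k g = (local (spine k) g * directed k.+1 g)%g.
Proof.
apply: app_ext => s sl; rewrite app_mul !app_aut ?act_vertex // -actU; last first.
  move=> u v /eqP-> /andP[kv /eqP vE]; rewrite vE.
  apply/andP; split; apply/negP => /prefix_spine; lia.
apply: act_eq => u; rewrite /above /=; apply/andP/orP.
  move=> [ku /eqP uE]; have [kE|nku] := eqVneq (size u).-1 k.
    by left; apply/eqP; rewrite uE kE.
  by right; rewrite -uE eqxx andbT; lia.
move=> [/eqP->|/andP[ku uE]]; first by rewrite size_spine ltnSn.
by split=> //; lia.
Qed.

Lemma app_directed_out k g s : ~~ prefix (nseq k 0%N) s -> app (directed k g) s = s.
Proof.
move=> ks; apply: app_aut_out => u /andP[ku /eqP uE]; apply: contra ks.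
apply: prefix_trans; rewrite uE /spine -cats1 prefix_catl //.
by rewrite prefixE size_nseq take_nseq //; lia.
Qed.

End Portraits.

(** * Commutators of elements with disjoint supports *)

Section Commutators.
Variable l : nat -> nat.
Implicit Types (g h : tree_aut l) (s : seq nat).
Local Open Scope group_scope.

Lemma commute_disjoint g h :
  (forall s, is_vertex l s -> app g s = s \/ app h s = s) -> commute g h.
Proof.
move=> gh; apply: app_ext => s sl; rewrite !app_mul.
have [gs|hs] := gh s sl.
  rewrite gs; have [->//|hhs] := gh (app h s) (etrans (is_vertex_app h s) sl).
  by rewrite (app_inj hhs) gs.
rewrite hs; have [ggs|->//] := gh (app g s) (etrans (is_vertex_app g s) sl).
by rewrite (app_inj ggs) hs.
Qed.

(** The factor [e * f] is common to both products and commutes with [x] and [y], so it cancels. Here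
    [e] and [f] will be the tails of two directed elements. *)
Lemma commg_mul (gT : groupType) (x y e f : gT) :
    commute e x -> commute e y -> commute f x -> commute f y -> commute e f ->
  [~ x * e, y * f] = [~ x, y].
Proof.
move=> ex ey fx fy ef.
have RE (p q : gT) : [~ p, q] = (q * p)^-1 * (p * q).
  by rewrite commgEl conjgE invgM !mulgA.
rewrite !RE.
have -> : x * e * (y * f) = x * y * (e * f) by rewrite -mulgA (mulgA e) ey -!mulgA.
have -> : y * f * (x * e) = y * x * (e * f).
  by rewrite -mulgA (mulgA f) fx -!mulgA -ef.
have efC p q : commute e p -> commute f p -> commute e q -> commute f q ->
    commute (e * f) (p * q).
  move=> ep fp eq fq; apply: commuteM; apply/commute_sym/commuteM;
    exact/commute_sym.
have cw : commute (e * f) ((y * x)^-1 * (x * y)).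
  by apply: commuteM; [apply: commuteV|]; apply: efC.
have -> : (y * x * (e * f))^-1 * (x * y * (e * f)) =
    (e * f)^-1 * ((y * x)^-1 * (x * y) * (e * f)) by rewrite invgM !mulgA.
by rewrite -cw mulKg.
Qed.

End Commutators.

Section Subgroups.
Variable gT : groupType.
Variable H : set gT.
Hypothesis Hgrp : subgroup H.
Local Open Scope group_scope.

Lemma subgroup1 : H 1.
Proof. by case: Hgrp; rewrite inE. Qed.

Lemma subgroupV x : H x -> H x^-1.
Proof.
move=> Hx; have := group_closedV Hgrp; move=> /(_ x).
by rewrite !inE; apply.
Qed.

Lemma subgroupM x y : H x -> H y -> H (x * y).
Proof.
move=> Hx Hy; have := group_closedM Hgrp; move=> /(_ x y).
by rewrite !inE; apply.
Qed.

Lemma subgroupJ x y : H x -> H y -> H (x ^ y).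
Proof.
move=> Hx Hy; rewrite conjgE; do 2?apply: subgroupM => //.
exact: subgroupV.
Qed.

Lemma subgroupR x y : H x -> H y -> H [~ x, y].
Proof. by move=> Hx Hy; apply: subgroupM (subgroupJ _ _) => //; apply: subgroupV. Qed.

End Subgroups.

Section LocalSubgroups.
Variables m l : nat -> nat.
Hypothesis le_ml : forall k, (m k <= l k)%N.
Notation family := (forall k, 'S_(m k)).
Local Open Scope group_scope.

(** Turns one permutation into a family that is trivial at the other levels; deciding [k = j]
    supplies the equality along which [s] is transported. *)
Definition at_level k (s : 'S_(m k)) : family :=
  fun j => if k =P j is ReflectT e then ecast i 'S_(m i) e s else 1.

Lemma at_levelE k (s : 'S_(m k)) : at_level s k = s.
Proof. by rewrite /at_level; case: eqP => // e; rewrite eq_axiomK. Qed.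

Lemma local_at_level v (g : family) :
  local le_ml v (at_level (g (size v))) = local le_ml v g.
Proof. by apply: local_eq; rewrite at_levelE. Qed.

(** Because these permutations form a group, containment of Alt need only be checked on
    generators. *)
Lemma local_group_set (H : set (tree_aut l)) v : subgroup H ->
  group_set [set s : 'S_(m (size v)) | `[< H (local le_ml v (at_level s)) >]]%SET.
Proof.
move=> Hgrp; apply/group_setP; split=> [|s t]; rewrite !inE.
  have -> : local le_ml v (at_level (1 : 'S_(m (size v)))) = 1.
    by rewrite -(aut1 le_ml (pred1 v)); apply: local_eq; rewrite at_levelE.
  exact: subgroup1.
move=> Hs Ht.
suff -> : local le_ml v (at_level (s * t)) =
    local le_ml v (at_level s) * local le_ml v (at_level t).
  exact: subgroupM.
by rewrite -autM; apply: local_eq; rewrite !at_levelE.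
Qed.

Lemma localR v (g h : family) :
  [~ local le_ml v g, local le_ml v h] = local le_ml v (fun k => [~ g k, h k]).
Proof.
rewrite /commg !conjgE -!autV -!autM; apply: local_eq.
by rewrite /commg !conjgE.
Qed.

End LocalSubgroups.

(** * Alternating groups at every vertex of the subtree *)

Section DenseGroup.
Variables m l : nat -> nat.
Hypothesis le_ml : forall k, (m k <= l k)%N.
Hypothesis m_ge5 : forall k, (5 <= m k)%N.
Notation family := (forall k, 'S_(m k)).
Notation local := (local le_ml).
Notation directed := (directed le_ml).
Local Open Scope group_scope.

Variables a b : family.
Hypothesis genAlt : forall k, 'Alt_('I_(m k)) = <<[set a k; b k]%SET>>.

Variable H : set (tree_aut l).
Hypothesis Hgrp : subgroup H.
Hypotheses (Ha : H (local [::] a)) (Hb : H (local [::] b)).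
Hypotheses (Hda : H (directed 0 a)) (Hdb : H (directed 0 b)).

Definition contains_alt k := forall v (g : family),
  is_vertex m v -> size v = k -> g k \in 'Alt_('I_(m k)) -> H (local v g).

Lemma is_vertex_le v : is_vertex m v -> is_vertex l v.
Proof.
move=> /is_vertexP vm; apply/is_vertexP => i iv.
by apply: leq_trans (vm i iv) (le_ml i).
Qed.

(** The prefix is corrected letter by letter, each time by an even permutation at the vertex already
    reached. Such elements leave the rest of the word alone, as [local_conj] requires. *)
Lemma rigid_transitive k u v : (forall j, (j < k)%N -> contains_alt j) ->
    is_vertex m u -> is_vertex m v -> size u = k -> size v = k ->
  exists2 w, H w &
    forall s, is_vertex l (u ++ s) -> app w (u ++ s) = v ++ s.
Proof.
elim: k u v => [|k IH] u v Hk um vm uk vk.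
  exists 1; first exact: subgroup1.
  by move=> s _; rewrite app1 (size0nil uk) (size0nil vk).
case/lastP: u um uk => // u x; rewrite is_vertex_rcons size_rcons => /andP[um xm] [uk].
case/lastP: v vm vk => // v y; rewrite is_vertex_rcons size_rcons => /andP[vm ym] [vk].
have [j jk|w Hw wE] := IH u v _ um vm uk vk; first exact/Hk/ltnW.
rewrite uk in xm; rewrite vk in ym.
have cm : (3 < #|'I_(m k)|)%N by rewrite card_ord; apply: leq_trans (m_ge5 k).
have [c cA cxy] := Alt_transitive (Ordinal xm) (Ordinal ym) cm.
exists (w * local v (at_level c)).
  by apply: subgroupM => //; apply: (Hk k) => //; rewrite at_levelE.
move=> s; rewrite app_mul !cat_rcons => usl.
have vsl : is_vertex l (v ++ x :: s) by rewrite -wE // is_vertex_app.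
rewrite wE // app_local // vk at_levelE; congr (_ ++ _ :: _).
by rewrite -[x]/(val (Ordinal xm)) pnatE cxy.
Qed.

(** The values at coordinate [i] of the directed elements of [H] form a group containing the
    generators of Alt. The other coordinates of [g] remain uncontrolled. *)
Lemma directed_section k i (c : 'S_(m i)) :
    H (directed k a) -> H (directed k b) -> c \in 'Alt_('I_(m i)) ->
  exists2 g : family, g i = c & H (directed k g).
Proof.
move=> Hka Hkb.
pose K := [set c : 'S_(m i) |
  `[< exists2 g : family, g i = c & H (directed k g) >]]%SET.
have gK : group_set K.
  apply/group_setP; split=> [|s t]; rewrite !inE.
    exists (fun=> 1) => //.
    by rewrite [directed _ _](aut1 le_ml); apply: subgroup1.
  move=> [g <- Hg] [h <- Hh].
  exists (fun k => g k * h k) => //.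
  by rewrite [directed _ _](autM le_ml); apply: subgroupM.
have: 'Alt_('I_(m i)) \subset Group gK.
  rewrite genAlt gen_subG; apply/fintype.subsetP => s /set2P[] ->.
    by rewrite inE; apply: asboolT; exists a.
  by rewrite inE; apply: asboolT; exists b.
by move=> /fintype.subsetP AK /AK; rewrite inE => /asboolP.
Qed.

Lemma spine_vertex k : is_vertex m (spine k).
Proof.
apply/is_vertexP => i _; rewrite /spine nth_rcons size_nseq nth_nseq.
by have := m_ge5 i; case: ifP => _; case: ifP => _; lia.
Qed.

Lemma nseq0_vertex k : is_vertex m (nseq k 0%N).
Proof. by apply: is_vertex_prefix (spine_vertex k); apply: prefix_rcons. Qed.

Lemma exists_alt_fix n : (5 <= n)%N -> exists2 c : 'S_n, c \in 'Alt_('I_n) &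
  pnat c 0 = 2%N /\ pnat c 1 = 1%N.
Proof.
case: n => [|[|[|[|[|n]]]]] // _.
pose o (k : nat) : 'I_n.+4.+1 := inord k.
(* The second transposition makes the permutation even; it is disjoint from 0, 1 and 2, which takes
   five letters. *)
exists (tperm (o 0%N) (o 2%N) * tperm (o 3%N) (o 4%N)).
  by rewrite Alt_even odd_permM !odd_tperm -!val_eqE /= !inordK.
have pE (p : 'S_(n.+4.+1)) k : (k < n.+4.+1)%N -> pnat p k = p (o k).
  by move=> kn; rewrite -pnatE /= inordK.
by split; rewrite pE // permM ?tpermL !tpermD -?val_eqE /= ?inordK.
Qed.

(* Segal's commutator trick: conjugating by [C], which fixes the letter 1 and
   sends 0 to 2 below [0^k], leaves two directed elements overlapping only at
   the vertex [spine k]. *)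
Lemma contains_alt_step k :
    (forall j, (j <= k)%N -> contains_alt j) ->
    H (directed k a) -> H (directed k b) ->
  [/\ contains_alt k.+1, H (directed k.+1 a) & H (directed k.+1 b)].
Proof.
move=> Hk Hka Hkb.
have [c cA [c0 c1]] := exists_alt_fix (m_ge5 k).
pose C := local (nseq k 0%N) (at_level c).
have HC : H C.
  apply: (Hk k) => //; first exact: nseq0_vertex.
    by rewrite size_nseq.
  by rewrite at_levelE.
have CE x s : is_vertex l (nseq k 0%N ++ x :: s) ->
    app C (nseq k 0%N ++ x :: s) = nseq k 0%N ++ pnat c x :: s.
  by move=> xl; rewrite app_local // size_nseq at_levelE.
have spineE k' : spine k' = nseq k' 0%N ++ [:: 1%N] by rewrite /spine cats1.
have vl := is_vertex_le (spine_vertex k).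
have comm (g h : family) :
    [~ directed k g, directed k h ^ C] = local (spine k) (fun j => [~ g j, h j]).
  rewrite -localR (directedE le_ml k g) (directedE le_ml k h) conjMg.
  have -> : local (spine k) h ^ C = local (spine k) h.
    apply: local_conj => // s; rewrite spineE -catA /= => sl.
    by rewrite CE // c1.
  have dir_out f s : is_vertex l s -> ~~ prefix (nseq k.+1 0%N) s ->
      app (directed k.+1 f) s = s.
    by move=> _; apply: app_directed_out.
  have zl : is_vertex l (nseq k.+1 0%N) by apply/is_vertex_le/nseq0_vertex.
  have dirC_out f s : is_vertex l s ->
      ~~ prefix (nseq k 0%N ++ [:: 2%N]) s -> app (directed k.+1 f ^ C) s = s.
    move=> sl; rewrite conjgE !app_mul => ks.
    rewrite app_directed_out ?appVK //; apply: contra ks => ks.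
    have : is_vertex l (app C^-1 s) by rewrite is_vertex_app.
    move=> /prefix_app /(_ ks) => /(_ C); rewrite appVK.
    by rewrite -addn1 nseqD CE ?c0 // -[[:: 0%N]]/(nseq 1 0%N) -nseqD addn1.
  (* The supports of the local factor, the tail and the conjugated tail are told apart by the letter
     at position [k], which is 1, 0 and 2 respectively. *)
  have nspine f s : app (local (spine k) f) s = s \/ nth 0%N s k = 1%N.
    have [/prefixP[t ->]|ns] := boolP (prefix (spine k) s).
      by right; rewrite nth_cat size_spine ltnSn nth_rcons size_nseq ltnn eqxx.
    by left; apply: app_local_out.
  have ndir f s : is_vertex l s -> app (directed k.+1 f) s = s \/ nth 0%N s k = 0%N.
    move=> sl; have [/prefixP[t ->]|ns] := boolP (prefix (nseq k.+1 0%N) s).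
      by right; rewrite nth_cat size_nseq ltnSn nth_nseq; case: ifP.
    by left; apply: dir_out.
  have ndirC f s : is_vertex l s ->
      app (directed k.+1 f ^ C) s = s \/ nth 0%N s k = 2%N.
    move=> sl; have [/prefixP[t ->]|ns] := boolP (prefix (nseq k 0%N ++ [:: 2%N]) s).
      by right; rewrite -catA nth_cat size_nseq ltnn subnn.
    by left; apply: dirC_out.
  apply: commg_mul; apply: commute_disjoint => s sl.
  - by have [->|] := ndir g s sl; [left|have [->|->] := nspine g s; [right|]].
  - by have [->|] := ndir g s sl; [left|have [->|->] := nspine h s; [right|]].
  - by have [->|] := ndirC h s sl; [left|have [->|->] := nspine g s; [right|]].
  - by have [->|] := ndirC h s sl; [left|have [->|->] := nspine h s; [right|]].
  - by have [->|] := ndir g s sl; [left|have [->|->] := ndirC h s sl; [right|]].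
have Hspine (g : family) : g k.+1 \in 'Alt_('I_(m k.+1)) -> H (local (spine k) g).
  pose K := Group (local_group_set le_ml (spine k) Hgrp).
  (* As Alt is perfect, commutators suffice. The commutator of [g0] with the conjugate of [h0] sees
     only their values at level [k.+1], so the uncontrolled coordinates do no harm. *)
  have cK : 'Alt_('I_(m (size (spine k)))) \subset K.
    rewrite -der1_Alt ?card_ord; last by apply: leq_trans (m_ge5 _).
    rewrite gen_subG; apply/fintype.subsetP => _ /imset2P[s t sA tA ->].
    have [g0 gs Hg0] := directed_section Hka Hkb sA.
    have [h0 hs Hh0] := directed_section Hka Hkb tA.
    rewrite inE; apply: asboolT.
    suff -> : local (spine k) (at_level [~ s, t]) =
        local (spine k) (fun j => [~ g0 j, h0 j]).
      by rewrite -comm; apply: subgroupR => //; apply: subgroupJ.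
    by apply: local_eq; rewrite at_levelE gs hs.
  rewrite -(size_spine k) => gA; rewrite -local_at_level.
  by have := fintype.subsetP cK _ gA; rewrite inE => /asboolP.
have Hdir (g : family) : g k.+1 \in 'Alt_('I_(m k.+1)) -> H (directed k g) ->
    H (directed k.+1 g).
  move=> /Hspine Hg; rewrite directedE => Hd.
  by rewrite -(mulKg (local (spine k) g) (directed k.+1 g)); apply: subgroupM => //;
    apply: subgroupV.
have in_Alt j (x : 'S_(m j)) : x \in [set a j; b j]%SET -> x \in 'Alt_('I_(m j)).
  by move=> xab; rewrite genAlt mem_gen.
split; last 2 first.
- by apply: Hdir => //; apply: in_Alt; rewrite !inE eqxx.
- by apply: Hdir => //; apply: in_Alt; rewrite !inE eqxx orbT.
move=> v g vm vk gA.
(* A rigid move conjugates the local elements at [spine k] to those at any vertex [v] of the same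
   level. *)
have [w Hw wE] := @rigid_transitive k.+1 _ _ Hk (spine_vertex k) vm (size_spine k) vk.
by rewrite -(local_conj le_ml g vl wE); apply: subgroupJ => //; apply: Hspine.
Qed.

(** The induction carries the truncated directed generators along; at the root, the two local
    generators already give Alt. *)
Lemma contains_all_alt k : contains_alt k.
Proof.
suff : [/\ forall j, (j <= k)%N -> contains_alt j, H (directed k a) & H (directed k b)].
  by case=> h _ _; apply: h.
elim: k => [|k [IH Hka Hkb]].
  split=> // j; rewrite leqn0 => /eqP-> v g _ /size0nil->.
  pose K := Group (local_group_set le_ml [::] Hgrp).
  have AK : 'Alt_('I_(m 0%N)) \subset K.
    rewrite genAlt gen_subG; apply/fintype.subsetP => s /set2P[] ->; rewrite inE;
      by apply: asboolT; rewrite (local_at_level le_ml [::]).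
  move=> gA; rewrite -local_at_level.
  by have := fintype.subsetP AK _ gA; rewrite inE => /asboolP.
have [Hk Ha' Hb'] := contains_alt_step IH Hka Hkb.
by split=> // j; rewrite leq_eqVlt => /predU1P[->|/IH].
Qed.

End DenseGroup.

Local Open Scope classical_set_scope.

(** * Congruence quotients *)

Section Index.
Variable gT : groupType.
Variables H K : set gT.
Hypotheses (Kgrp : subgroup K).
Local Open Scope group_scope.

Lemma eq_left_coset x y : left_coset x K = left_coset y K <-> K (x^-1 * y).
Proof.
split=> [xy|Kxy].
  have : left_coset y K y by exists 1; rewrite ?mulg1 //; apply: subgroup1.
  by rewrite -xy => -[k Kk <-]; rewrite mulKg.
have Kyx : K (y^-1 * x) by have := subgroupV Kgrp Kxy; rewrite invgM invgK.
apply/seteqP; split=> _ [k Kk <-].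
  by exists (y^-1 * x * k); rewrite ?mulgA ?mulVKg ?mulgV ?mul1g //; apply: subgroupM.
by exists (x^-1 * y * k); rewrite ?mulgA ?mulVKg ?mulgV ?mul1g //; apply: subgroupM.
Qed.

(** A label from a finite type that determines the coset yields finiteness of the index together
    with the bound. *)
Lemma index_upper (J : finType) (phi : gT -> J) :
    (forall x y, H x -> H y -> phi x = phi y -> K (x^-1 * y)) ->
  finite_index H K /\ (Defs.index H K <= #|J|)%N.
Proof.
move=> phiP.
pose f (j : J) : set gT :=
  if pselect (exists2 x, H x & phi x = j) is left e then left_coset (projT1 (cid2 e)) K
  else set0.
have sub : left_cosets H K `<=` range f.
  move=> _ [x Hx <-]; exists (phi x) => //; rewrite /f.
  case: pselect => [e|[]]; last by exists x.
  by case: cid2 => y Hy /= yx; apply/eq_left_coset/phiP.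
have finf : finite_set (range f) by apply: finite_image; apply: finite_finset.
have fin : finite_index H K by apply: sub_finite_set finf.
split=> //; rewrite /Defs.index.
apply: (@leq_trans #|` [fset f j | j in J]%fset|); last first.
  by apply: leq_trans (leq_imfset_card _ _ _) _; rewrite cardE.
apply: fsubset_leq_card; apply/fsubsetP => C; rewrite in_fset_set // inE.
by move=> /sub[j _ <-]; apply/imfsetP; exists j.
Qed.

(** Finiteness is assumed because [index] takes the value 0 on an infinite index. *)
Lemma index_lower (I : finType) (F : I -> gT) : finite_index H K ->
    (forall i, H (F i)) -> (forall i j, K ((F i)^-1 * F j) -> i = j) ->
  (#|I| <= Defs.index H K)%N.
Proof.
move=> fin HF FP.
pose f (i : I) : set gT := left_coset (F i) K.
have f_inj : injective f by move=> i j /eq_left_coset/FP.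
apply: (@leq_trans #|` [fset f i | i in I]%fset|).
  by rewrite card_imfset //= cardE.
apply: fsubset_leq_card; apply/fsubsetP => C /imfsetP[i _ ->].
by rewrite in_fset_set // inE; exists (F i).
Qed.

End Index.

Section LevelVertices.
Variable m : nat -> nat.

Fixpoint level_vertices n : finType :=
  if n is n'.+1 then (level_vertices n' * 'I_(m n'))%type else unit.

Fixpoint word n : level_vertices n -> seq nat :=
  match n with
  | 0 => fun=> [::]
  | n'.+1 => fun v : level_vertices n' * 'I_(m n') => rcons (word v.1) v.2
  end.

Lemma size_word n (v : level_vertices n) : size (word v) = n.
Proof. by elim: n v => //= n IH [v x] /=; rewrite size_rcons IH. Qed.

Lemma word_vertex n (v : level_vertices n) : is_vertex m (word v).
Proof.
elim: n v => [v|n IH v]; first exact: is_vertex_nil.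
by rewrite /= is_vertex_rcons IH size_word ltn_ord.
Qed.

Lemma word_inj n : injective (@word n).
Proof.
elim: n => [|n IH] /=; first by move=> [] [].
move=> [v x] [w y] /= /eqP; rewrite eqseq_rcons => /andP[/eqP/IH-> /eqP/val_inj->].
by [].
Qed.

Lemma word_surj n s : is_vertex m s -> size s = n ->
  exists v : level_vertices n, word v = s.
Proof.
elim: n s => [|n IH] s; first by move=> _ /size0nil->; exists tt.
case/lastP: s => // s x; rewrite is_vertex_rcons size_rcons => /andP[sm xm] [sn].
have [v vE] := IH s sm sn; rewrite sn in xm.
by exists (v, Ordinal xm); rewrite /= vE.
Qed.

Lemma card_level_vertices n : #|level_vertices n| = (\prod_(k < n) m k)%N.
Proof.
elim: n => [|n IH]; first by rewrite big_ord0 card_unit.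
by rewrite big_ord_recr card_prod IH card_ord.
Qed.

(** An element of [P k] chosen at every vertex of level [k], for all [k < n]. *)
Fixpoint portrait (P : forall k, {set 'S_(m k)}) n : finType :=
  if n is n'.+1
  then (portrait P n' * {ffun level_vertices n' -> {s : 'S_(m n') | s \in P n'}})%type
  else unit.

Lemma card_portrait (P : forall k, {set 'S_(m k)}) n :
  #|portrait P n| = (\prod_(k < n) #|P k| ^ (\prod_(j < k) m j))%N.
Proof.
elim: n => [|n IH]; first by rewrite big_ord0 card_unit.
by rewrite big_ord_recr card_prod IH card_ffun card_level_vertices card_sig.
Qed.

End LevelVertices.

(** * Upper bound for the index of level stabilizers *)

Section UpperBound.
Variables m l : nat -> nat.
Hypothesis le_ml : forall k, (m k <= l k)%N.
Implicit Types (g h : tree_aut l) (s t : seq nat) (A : pred (seq nat)).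

(* [g] is induced by an automorphism of the subtree [T_m] of [T_l]. *)
Definition supported g : Prop :=
  (forall s, is_vertex m s -> is_vertex m (app g s)) /\
  (forall s y t, is_vertex m s -> (m (size s) <= y)%N ->
     is_vertex l (s ++ y :: t) -> app g (s ++ y :: t) = app g s ++ y :: t).

(** Imposing the condition on the inverse too makes closure under inversion immediate. *)
Definition biSupported : set (tree_aut l) :=
  [set g | supported g /\ supported g^-1%g].

Lemma supportedM g h : supported g -> supported h -> supported (g * h)%g.
Proof.
move=> [g1 g2] [h1 h2]; split=> [s sm|s y t sm my stl]; rewrite !app_mul.
  by apply/h1/g1.
rewrite g2 // h2 ?size_app ?g1 // -g2 // is_vertex_app //.
Qed.

Lemma biSupported_subgroup : subgroup biSupported.
Proof.
split.
  rewrite inE; split; first by split=> [s|s y t] *; rewrite !app1.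
  by rewrite invg1; split=> [s|s y t] *; rewrite !app1.
move=> g h; rewrite !inE => -[g1 g2] [h1 h2]; split; first exact: supportedM.
by rewrite invgM invgK; apply: supportedM.
Qed.

Lemma act_cat_out A (f : forall k, 'S_(m k)) i s y t : (m (i + size s) <= y)%N ->
    (forall u, A u -> ~~ prefix (rcons s y) u) ->
  act A f i (s ++ y :: t) = act A f i s ++ y :: t.
Proof.
elim: s A i => [|x s IH] A i /= my As.
  rewrite addn0 in my; case: ifPn => [_|A0]; first by rewrite pnat_out.
  by rewrite act_out // => u /As; rewrite prefix_cons eqxx prefix0s.
case: ifPn => // A0; rewrite IH ?addSnnS // => u /As.
by rewrite prefix_cons eqxx.
Qed.

Lemma supported_aut A (f : forall k, 'S_(m k)) :
  (forall u, A u -> is_vertex m u) -> supported (aut le_ml A f).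
Proof.
move=> Am; split=> [s sm|s y t sm my stl].
  rewrite app_aut; last exact: is_vertex_le sm.
  exact: act_vertex.
rewrite !app_aut //; last exact: is_vertex_le sm.
apply: act_cat_out => // u /Am um; apply/negP => /is_vertex_prefix/(_ um).
by rewrite is_vertex_rcons ltnNge my andbF.
Qed.

Lemma biSupported_aut A (f : forall k, 'S_(m k)) :
  (forall u, A u -> is_vertex m u) -> biSupported (aut le_ml A f).
Proof. by move=> Am; split; rewrite -?autV; apply: supported_aut. Qed.

(** The default [x] here, and the identity in [local_perm], are never reached when [g] is supported,
    [s] lies in the subtree and [n] is [m (size s)]. *)
Definition local_fun g s n (x : 'I_n) : 'I_n :=
  insubd x (last 0%N (app g (rcons s x))).

Definition local_perm g s n : 'S_n := 
  odflt 1%g (insub [ffun x => local_fun g s x] : option {perm 'I_n}).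

Lemma local_permE g s (x : 'I_(m (size s))) : supported g -> is_vertex m s ->
  app g (rcons s x) = rcons (app g s) (local_perm g s (m (size s)) x).
Proof.
move=> [g1 _] sm.
have sxm (y : 'I_(m (size s))) : is_vertex m (rcons s y).
  by rewrite is_vertex_rcons sm ltn_ord.
have funE (y : 'I_(m (size s))) : app g (rcons s y) = rcons (app g s) (local_fun g s y).
  have sxl := is_vertex_le le_ml (sxm y).
  have := prefix_app g sxl (prefix_rcons s y).
  have szx := size_app g (rcons s y); have sz := size_app g s.
  move=> /prefixP[r rE]; have szr : size r = 1%N.
    by have := congr1 size rE; rewrite size_cat szx size_rcons sz; lia.
  case: r szr rE => // z [|//] _ rE; rewrite rE cats1; congr rcons.
  have := g1 _ (sxm y); rewrite rE cats1 is_vertex_rcons sz => /andP[_ zm].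
  by rewrite /local_fun rE cats1 last_rcons val_insubd zm.
have inj : injectiveb [ffun y : 'I_(m (size s)) => local_fun g s y].
  apply/injectiveP => y z; rewrite !ffunE => yz.
  have : app g (rcons s y) = app g (rcons s z) by rewrite !funE yz.
  by move=> /app_inj/eqP; rewrite eqseq_rcons => /andP[_ /eqP/val_inj].
rewrite funE; congr rcons; congr val; rewrite -pvalE /local_perm.
by case: insubP => [p _ ->|]; [rewrite ffunE|rewrite inj].
Qed.

Notation all_perms := (fun k => [set: 'S_(m k)]%SET).

Fixpoint portrait_of n g : portrait all_perms n :=
  match n return portrait all_perms n with
  | 0 => tt
  | n'.+1 => (portrait_of n' g,
      [ffun v => exist _ (local_perm g (word v) (m n')) (finset.in_setT _)])
  end.

Lemma split_word s : is_vertex m s \/ exists p y t,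
  [/\ s = p ++ y :: t, is_vertex m p & (m (size p) <= y)%N].
Proof.
elim/last_ind: s => [|s x [sm|[p [y [t [-> pm my]]]]]].
- by left; apply/is_vertexP.
- rewrite is_vertex_rcons sm; case: ltnP => [|my]; [by left|right].
  by exists s, x, [::]; rewrite cats1.
- by right; exists p, y, (rcons t x); rewrite rcons_cat rcons_cons.
Qed.

(** Inside the subtree the portrait gives the image letter by letter; from the first letter that
    leaves the subtree on, a supported element changes nothing. *)
Lemma portrait_of_eq n g h : supported g -> supported h ->
    portrait_of n g = portrait_of n h ->
  forall s, is_vertex l s -> (size s <= n)%N -> app g s = app h s.
Proof.
move=> gs hs E.
suff Em s : is_vertex m s -> (size s <= n)%N -> app g s = app h s.
  move=> s sl sn; have [sm|[p [y [t [sE pm my]]]]] := split_word s; first exact: Em.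
  rewrite sE in sl sn *; rewrite gs.2 // hs.2 // Em //.
  by apply: leq_trans sn; rewrite size_cat leq_addr.
have nilE f : app f [::] = [::] by apply: size0nil; rewrite size_app.
elim: n s E => [|n IH] s /=.
  by move=> _ _; rewrite leqn0 => /eqP/size0nil->; rewrite !nilE.
case=> E1 /ffunP E2; case/lastP: s => [_ _|s x]; first by rewrite !nilE.
rewrite is_vertex_rcons size_rcons ltnS => /andP[sm xm].
rewrite leq_eqVlt => /predU1P[sn|sn]; last first.
  by apply: IH => //; rewrite ?is_vertex_rcons ?sm ?size_rcons.
have [v vE] := word_surj sm sn.
have := E2 v; rewrite !ffunE vE => -[E3].
rewrite -[x]/(val (Ordinal xm)) !local_permE //; subst n; rewrite E3.
by rewrite IH.
Qed.

Lemma level_stabilizer_subgroup (G : set (tree_aut l)) n :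
  subgroup G -> subgroup (level_stabilizer G n).
Proof.
move=> Ggrp; split=> [|g h]; rewrite ?inE.
  by split=> //; apply: subgroup1 Ggrp.
move=> [Gg gn] [Gh hn]; split.
  by apply: (subgroupM Ggrp) => //; apply: (subgroupV Ggrp).
move=> u un; apply: val_inj; rewrite -appE app_mul appE gn //.
by apply: (@app_inj _ h); rewrite appVK appE hn.
Qed.

Lemma subgroupI (gT : groupType) (H K : set gT) :
  subgroup H -> subgroup K -> subgroup (H `&` K).
Proof.
move=> [H1 HD] [K1 KD]; split; first by rewrite !inE in H1 K1 *.
move=> x y; have := HD x y; have := KD x y; rewrite !inE.
by move=> Kxy Hxy [Hx Kx] [Hy Ky]; split; [apply: Hxy|apply: Kxy].
Qed.

Lemma level_stabilizerP (G : set (tree_aut l)) n g h : subgroup G -> G g -> G h ->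
  level_stabilizer G n (g^-1 * h)%g <->
  forall s, is_vertex l s -> size s = n -> app g s = app h s.
Proof.
move=> Ggrp Gg Gh; split=> [[_ gh] s sl sn|gh].
  have gl : is_vertex l (app g s) by rewrite is_vertex_app.
  have := congr1 val (gh (Vertex gl) _); rewrite -appE app_mul /= appK => -> //.
  by rewrite /level /= size_app.
split; first by apply: (subgroupM Ggrp) => //; apply: (subgroupV Ggrp).
move=> u un; apply: val_inj; rewrite -appE app_mul -gh ?appVK //.
  by rewrite is_vertex_app; apply: valP.
by rewrite size_app.
Qed.

Lemma index_level_le (G H : set (tree_aut l)) n :
    subgroup G -> subgroup H -> H `<=` G -> H `<=` biSupported ->
  finite_index H (H `&` level_stabilizer G n) /\
  (Defs.index H (H `&` level_stabilizer G n)
    <= \prod_(k < n) (m k)`! ^ (\prod_(j < k) m j))%N.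
Proof.
move=> Ggrp Hgrp HG Hsupp.
have -> : (\prod_(k < n) (m k)`! ^ (\prod_(j < k) m j))%N = #|portrait all_perms n|.
  by rewrite card_portrait; apply: eq_bigr => k _; rewrite cardsT card_Sn.
have Kgrp : subgroup (H `&` level_stabilizer G n).
  by apply: subgroupI => //; apply: level_stabilizer_subgroup.
apply: (index_upper Kgrp (phi := portrait_of n)).
move=> x y Hx Hy xy; split.
  by apply: (subgroupM Hgrp) => //; apply: (subgroupV Hgrp).
apply/level_stabilizerP => //; [exact: HG|exact: HG|move=> s sl sn].
have [[xs _] [ys _]] := (Hsupp _ Hx, Hsupp _ Hy).
by apply: (portrait_of_eq xs ys xy); rewrite ?sn.
Qed.

End UpperBound.

(** * Lower bound for the index of level stabilizers *)

Section LowerBound.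
Variables m l : nat -> nat.
Hypothesis le_ml : forall k, (m k <= l k)%N.
Variable H : set (tree_aut l).
Hypothesis Hgrp : subgroup H.
Hypothesis m_gt0 : forall k, (0 < m k)%N.
Hypothesis H_alt : forall k, contains_alt le_ml H k.

Notation alts := (fun k => ('Alt_('I_(m k)))%g : {set 'S_(m k)}).

Definition layer n (f : {ffun level_vertices m n -> {s : 'S_(m n) | s \in alts n}})
    (r : seq (level_vertices m n)) : tree_aut l :=
  (\prod_(v <- r) local le_ml (word v) (at_level (val (f v))))%g.

Lemma layer_in n f r : H (@layer n f r).
Proof.
rewrite /layer; elim: r => [|v r IH]; first by rewrite big_nil; apply: subgroup1.
rewrite big_cons; apply: (subgroupM Hgrp) => //.
apply: H_alt; [exact: word_vertex|exact: size_word|].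
by rewrite at_levelE; apply: valP.
Qed.

Lemma app_layer_le n f r s : (size s <= n)%N -> app (@layer n f r) s = s.
Proof.
move=> sn; rewrite /layer; elim: r => [|v r IH]; first by rewrite big_nil app1.
rewrite big_cons app_mul; have [/prefixP[[|x t] sE]|vs] := boolP (prefix (word v) s).
- by rewrite {1}sE cats0 app_local_self -[word v]cats0 -sE IH.
- by move: sn; rewrite sE size_cat size_word /=; lia.
- by rewrite app_local_out.
Qed.

Lemma app_layer n f r v (x : 'I_(m n)) : uniq r ->
  app (@layer n f r) (rcons (word v) x) =
  rcons (word v) (if v \in r then (val (f v)) x else x).
Proof.
have vxl (w : level_vertices m n) (y : 'I_(m n)) : is_vertex l (rcons (word w) y).
  apply: (is_vertex_le le_ml).
  by rewrite is_vertex_rcons size_word ltn_ord andbT word_vertex.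
rewrite /layer; elim: r x => [|w r IH] x; first by rewrite big_nil app1.
rewrite big_cons app_mul inE => /= /andP[wr ur].
move: wr; have [<-|nvw] := eqVneq v w => /= wr.
  rewrite -cats1 app_local ?cats1 // size_word at_levelE pnatE IH //.
  by rewrite (negPf wr).
rewrite app_local_out ?IH //; apply: contra nvw.
by rewrite prefixE size_word -cats1 take_size_cat ?size_word // => /eqP/word_inj->.
Qed.

Fixpoint realize n : portrait alts n -> tree_aut l :=
  match n return portrait alts n -> tree_aut l with
  | 0 => fun=> 1%g
  | n'.+1 => fun p => (realize p.1 * layer p.2 (enum (level_vertices m n')))%g
  end.

Lemma realize_in n p : H (@realize n p).
Proof.
elim: n p => [|n IH] p /=; first exact: subgroup1.
by apply: (subgroupM Hgrp) => //; apply: layer_in.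
Qed.

(** The last layer fixes all words of length at most its level, so the earlier layers are recovered
    from prefixes. Once these agree, the last layers can be compared. *)
Lemma realize_inj n (p q : portrait alts n) :
    (forall s, is_vertex l s -> size s = n -> app (realize p) s = app (realize q) s) ->
  p = q.
Proof.
elim: n p q => [|n IH]; first by move=> [] [].
move=> [p f] [q g] /= pq.
have wordl (v : level_vertices m n) (x : 'I_(m n)) : is_vertex l (rcons (word v) x).
  apply: (is_vertex_le le_ml).
  by rewrite is_vertex_rcons size_word ltn_ord andbT word_vertex.
have pqE : p = q.
  (* Level [n] is read off from level [n.+1] by appending the letter 0. *)
  apply: IH => t tl tn; have txl : is_vertex l (rcons t 0%N).
    by rewrite is_vertex_rcons tl; apply: leq_trans (m_gt0 _) (le_ml _).
  have := pq _ txl; rewrite size_rcons tn => /(_ erefl) /(congr1 (take n)).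
  have take_app (A : tree_aut l) : take n (app A (rcons t 0%N)) = app A t.
    have := prefix_app A txl (prefix_rcons t 0%N).
    by rewrite prefixE size_app tn => /eqP.
  by rewrite !take_app !app_mul !app_layer_le ?size_app ?tn.
rewrite -pqE in pq *; congr pair; apply/ffunP => v; apply/val_inj/permP => x.
(* The word is first pulled back through [realize p], so that the last layer meets it exactly at
   [v]. *)
have := pq (app (realize p)^-1%g (rcons (word v) x)).
rewrite is_vertex_app size_app size_rcons size_word wordl => /(_ isT erefl).
rewrite !app_mul !appVK !app_layer ?enum_uniq // mem_enum => /eqP.
by rewrite eqseq_rcons => /andP[_ /eqP/val_inj].
Qed.

Lemma index_level_ge (G : set (tree_aut l)) n :
    subgroup G -> H `<=` G -> finite_index H (H `&` level_stabilizer G n) ->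
  (\prod_(k < n) #|('Alt_('I_(m k)))%g| ^ (\prod_(j < k) m j)
    <= Defs.index H (H `&` level_stabilizer G n))%N.
Proof.
move=> Ggrp HG fin; rewrite -(card_portrait alts).
have Kgrp : subgroup (H `&` level_stabilizer G n).
  by apply: subgroupI => //; apply: level_stabilizer_subgroup.
apply: (index_lower Kgrp fin (F := @realize n)) => [p|p q [_ pq]].
  exact: realize_in.
apply: realize_inj; apply/(level_stabilizerP n Ggrp) => //;
  exact/HG/realize_in.
Qed.

End LowerBound.


Section Generated.
Variable gT : groupType.
Implicit Types (X H : set gT).

Lemma generated_subgroup X : subgroup (Defs.generated X).
Proof.
split.
  by rewrite inE => K [Kgrp _]; apply: subgroup1.
move=> x y; rewrite !inE => Hx Hy K KX; have [Kgrp _] := KX.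
by apply: (subgroupM Kgrp (Hx K KX)); apply: (subgroupV Kgrp (Hy K KX)).
Qed.

Lemma sub_generated X : X `<=` Defs.generated X.
Proof. exact: sub_gen_smallest. Qed.

Lemma generated_sub X H : subgroup H -> X `<=` H -> Defs.generated X `<=` H.
Proof. by move=> Hgrp XH; apply: smallest_sub. Qed.

End Generated.

Lemma dense_subgroup (m l : nat -> nat) (le_ml : forall k, (m k <= l k)%N) :
    (forall k, (5 <= m k)%N) ->
  exists H : set (tree_aut l), [/\ subgroup H, finitely_generated H,
    H `<=` biSupported m (l := l) & forall k, contains_alt le_ml H k].
Proof.
move=> m_ge5.
have gen2 : forall k, exists ab : 'S_(m k) * 'S_(m k),
    ('Alt_('I_(m k)))%g = <<[set ab.1; ab.2]%SET>>%g.
  move=> k; have [|a [b abE]] := @Alt_two_generated (m k).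
    by apply: leq_trans (m_ge5 k).
  by exists (a, b).
pose ab k := projT1 (cid (gen2 k)).
have abE k : ('Alt_('I_(m k)))%g = <<[set (ab k).1; (ab k).2]%SET>>%g.
  exact: projT2 (cid (gen2 k)).
pose X := [set
  local le_ml [::] (fun k => (ab k).1); local le_ml [::] (fun k => (ab k).2);
  directed le_ml 0 (fun k => (ab k).1); directed le_ml 0 (fun k => (ab k).2)].
exists (Defs.generated X); split.
- exact: generated_subgroup.
- by exists X => //; rewrite /X !finite_setU; split.
- apply: generated_sub; first exact: biSupported_subgroup.
  move=> _ [[[]|]|] ->; apply: biSupported_aut => u.
  + by move=> /eqP->; apply/is_vertexP.
  + by move=> /eqP->; apply/is_vertexP.
  + by move=> /andP[_ /eqP->]; apply: spine_vertex.
  + by move=> /andP[_ /eqP->]; apply: spine_vertex.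
- move=> k; apply: (contains_all_alt m_ge5 abE (generated_subgroup X));
    by apply: sub_generated; rewrite /X /=; tauto.
Qed.

(** * The full automorphism group is a branch group *)

Section FullGroup.
Variable l : nat -> nat.
Hypothesis l_ge5 : forall k, (5 <= l k)%N.

Lemma setT_subgroup : subgroup [set: tree_aut l].
Proof. by split=> [|x y]; rewrite !inE. Qed.

(** For [m = l] no vertex leaves the subtree, so the bounds proved for subgroups apply to the whole
    group. *)
Lemma biSupportedT : [set: tree_aut l] `<=` biSupported l (l := l).
Proof.
have supp (g : tree_aut l) : supported l g.
  split=> [s|s y t _ ly stl]; first by rewrite is_vertex_app.
  suff : is_vertex l (rcons s y) by rewrite is_vertex_rcons ltnNge ly andbF.
  by apply: is_vertex_prefix stl; rewrite -cat_rcons prefix_prefix.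
by move=> g _; split.
Qed.

Lemma level_transitiveT : level_transitive [set: tree_aut l].
Proof.
have [H [Hgrp _ _ Halt]] := dense_subgroup (fun k => leqnn (l k)) l_ge5.
move=> n u v un vn.
have [w _ wE] := rigid_transitive l_ge5 Hgrp (fun j _ => Halt j)
  (valP u) (valP v) un vn.
by exists w => //; apply: val_inj; rewrite -appE -[val u]cats0 wE cats0 //; apply: valP.
Qed.

Lemma prefix_comparable (s t u : seq nat) :
  prefix s t -> prefix u t -> prefix s u \/ prefix u s.
Proof.
rewrite !prefixE => /eqP sE /eqP uE; case: (leqP (size s) (size u)) => su.
  by left; rewrite -uE take_takel // sE.
by right; rewrite -sE take_takel ?uE // ltnW.
Qed.

Lemma restrict_subtree (g : tree_aut l) u : is_vertex l u -> app g u = u ->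
  exists h : tree_aut l, forall s, is_vertex l s ->
    app h s = if prefix u s then app g s else s.
Proof.
move=> ul gu.
have tm (f : tree_aut l) : app f u = u ->
    tree_map l (fun s => if prefix u s then app f s else s).
  move=> fu; split=> [s|s t tl st|s sl].
  - by case: ifP; rewrite ?size_app.
  - case: ifPn => us; first by rewrite (prefix_trans us st); apply: prefix_app.
    case: ifPn => // ut.
    have [su|] := prefix_comparable st ut; last by rewrite (negPf us).
    apply: prefix_trans (prefix_app f tl ut); rewrite fu //.
  - by case: ifP; rewrite ?is_vertex_app.
have giu : app g^-1%g u = u by rewrite -{1}gu appK.
apply: (tree_aut_of_map (tm g gu) (tm g^-1%g giu)) => s sl /=;
  have [us|us] := boolP (prefix u s); rewrite ?(negPf us) //.
  by rewrite -{1}gu prefix_appE // us appK.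
by rewrite -{1}giu prefix_appE // us appVK.
Qed.

(** An element fixing level [n] is the product of its restrictions to the subtrees at that level.
    They are stripped off one by one along a list [r] of vertices whose subtrees contain the
    support. *)
Lemma level_stabilizer_rigid n :
  level_stabilizer [set: tree_aut l] n `<=` rigid_level_stabilizer [set: tree_aut l] n.
Proof.
move=> g [_ gn].
have Kgrp := generated_subgroup
  (\bigcup_(u in level (l := l) n) rigid_vertex_stabilizer [set: tree_aut l] u).
have gfix u : is_vertex l u -> size u = n -> app g u = u.
  by move=> ul un; rewrite -[u]/(val (Vertex ul)) appE gn.
pose r := [seq word v | v <- enum (level_vertices l n)].
have : forall s, is_vertex l s -> ~ (exists2 u, u \in r & prefix u s) -> app g s = s.
  move=> s sl ns; have [sn|sn] := leqP n (size s).
    case: ns; have tl : is_vertex l (take n s).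
      by apply: is_vertex_prefix sl; apply: prefix_take.
    have [v vE] := word_surj tl (size_takel sn).
    exists (word v); last by rewrite vE prefix_take.
    by apply/mapP; exists v; rewrite ?mem_enum.
  (* A word shorter than [n] is a prefix of a vertex of level [n], obtained by appending zeros, and
     is therefore fixed. *)
  have tl : is_vertex l (s ++ nseq (n - size s) 0%N).
    apply/is_vertexP => i _; rewrite nth_cat nth_nseq.
    case: ifP => [|_]; first by move/is_vertexP: sl; apply.
    by rewrite if_same; apply: leq_trans (l_ge5 i).
  have tn : size (s ++ nseq (n - size s) 0%N) = n.
    by rewrite size_cat size_nseq subnKC // ltnW.
  have := prefix_app g tl (prefix_prefix s _); rewrite (gfix _ tl tn) prefixE size_app.
  by rewrite take_size_cat // => /eqP.
have : forall u, u \in r -> is_vertex l u /\ size u = n.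
  by move=> _ /mapP[v _ ->]; rewrite size_word word_vertex.
elim: r g gfix {gn} => [|u r IH] g gfix ur gr.
  suff -> : g = 1%g by apply: subgroup1.
  by apply: app_ext => s sl; rewrite app1 gr // => -[].
have [ul un] := ur u (mem_head _ _).
have [h hE] := restrict_subtree ul (gfix u ul un).
have Kh : rigid_level_stabilizer [set: tree_aut l] n h.
  apply: sub_generated; exists (Vertex ul) => //; split=> // v uv.
  by apply: val_inj; rewrite -appE hE ?ifN //; [apply/negP|apply: valP].
rewrite -(mulgVK h g); apply: (subgroupM Kgrp) => //.
have hfix w : is_vertex l w -> size w = n -> app (g * h^-1)%g w = w.
  move=> wl wn; rewrite app_mul gfix //; apply: (@app_inj _ h).
  by rewrite appVK hE // gfix // if_same.
apply: IH => // [w wr|s sl sr]; first by apply: ur; rewrite inE wr orbT.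
apply: (@app_inj _ h); rewrite app_mul appVK hE //; case: ifPn => // us.
apply: gr => // -[w]; rewrite inE => /predU1P[->|wr ws]; first by rewrite (negPf us).
by apply: sr; exists w.
Qed.

Lemma branchT : branch_group [set: tree_aut l].
Proof.
split; [exact: setT_subgroup|exact: level_transitiveT|move=> n].
have Kgrp := generated_subgroup
  (\bigcup_(u in level (l := l) n) rigid_vertex_stabilizer [set: tree_aut l] u).
have [|//] := index_upper (H := [set: tree_aut l]) Kgrp (phi := portrait_of l n).
move=> x y _ _ xy; apply: level_stabilizer_rigid.
apply/(level_stabilizerP n setT_subgroup) => // s sl sn.
have [xs _] := @biSupportedT x I; have [ys _] := @biSupportedT y I.
by apply: portrait_of_eq xs ys xy _ sl _; rewrite ?sn.
Qed.

End FullGroup.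

Local Open Scope ring_scope.

(** * Growth of the congruence quotients *)

Section Factorials.
Local Open Scope nat_scope.

(** Multiply the factorial by its reversal: each product [(i + 1) * (n - i)] is at least [n]. *)
Lemma leq_expn_fact_sq n : n ^ n <= n`! ^ 2.
Proof.
have factE : n`! = \prod_(i < n) i.+1 by rewrite fact_prod big_add1 /= big_mkord.
rewrite expnS expn1 {1}factE (reindex_inj rev_ord_inj) {1}factE -big_split /=.
rewrite -[X in X <= _](_ : \prod_(i < n) n = _); last first.
  by rewrite prod_nat_const card_ord.
apply: leq_prod => i _; have := ltn_ord i; nia.
Qed.

(** Each of the top [n - m] factors of the factorial is at most [n]. *)
Lemma leq_fact_expn m n : m <= n -> n`! <= m`! * n ^ (n - m).
Proof.
elim: n => [|n IH]; first by rewrite leqn0 => /eqP->.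
rewrite leq_eqVlt => /predU1P[->|mn]; first by rewrite subnn muln1.
rewrite factS subSn // expnS mulnCA leq_mul2l /=.
apply: leq_trans (IH mn) _; rewrite leq_mul2l.
by case: (n - m) => [|k]; rewrite ?leqnn ?leq_exp2r ?leqnSn ?orbT.
Qed.

End Factorials.

(** * Weighted averages and logarithms of factorials *)

Section Analysis.
Variable R : realType.
Implicit Types (u v w r : nat -> R).

Lemma toeplitz w r (a c : R) : 0 < c -> (forall k, c <= w k) ->
    r @ \oo --> a ->
  (fun n => (\sum_(k < n) w k * r k) / \sum_(k < n) w k) @ \oo --> a.
Proof.
move=> c0 cw ra; have w0 k : 0 < w k by apply: lt_le_trans (cw k).
have Wge n : c *+ n <= \sum_(k < n) w k.
  by rewrite -[in c *+ n](card_ord n) -sumr_const; apply: ler_sum.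
apply/cvgrPdist_le => e e0.
have e20 : 0 < e / 2 by rewrite divr_gt0.
have /cvgrPdist_le/(_ _ e20)[N _ Nr] := ra.
pose C := \sum_(k < N) w k * `|a - r k|.
have C0 : 0 <= C by apply: sumr_ge0 => k _; rewrite mulr_ge0 // ltW.
near=> n.
have Nn : (N <= n)%N by near: n; exact: nbhs_infty_ge.
have n0 : (0 < n)%N by near: n; exact: nbhs_infty_gt.
have W0 : 0 < \sum_(k < n) w k.
  by apply: lt_le_trans (Wge n); rewrite pmulrn_lgt0.
(* [C] is constant, while the total weight is at least [c * n]. *)
have CW : C <= e / 2 * \sum_(k < n) w k.
  apply: (@le_trans _ _ (e / 2 * (c *+ n))); last by rewrite ler_pM2l.
  rewrite -[c *+ n]mulr_natr mulrA -ler_pdivrMl ?mulr_gt0 //.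
  near: n; exact: nbhs_infty_ger.
rewrite -[a in `|a - _|](mulfK (lt0r_neq0 W0)) -mulrBl normrM normfV.
rewrite (gtr0_norm W0) ler_pdivrMr // mulr_sumr -sumrB.
apply: le_trans (ler_norm_sum _ _ _) _.
have -> : \sum_(k < n) `|a * w k - w k * r k| = \sum_(k < n) w k * `|a - r k|.
  by apply: eq_bigr => k _; rewrite mulrC -mulrBr normrM gtr0_norm.
rewrite -(big_mkord predT (fun k => w k * `|a - r k|)) (big_cat_nat (leq0n N) Nn) /=.
rewrite big_mkord -/C [e]splitr mulrDl lerD //.
rewrite -(big_mkord predT w) (big_cat_nat (leq0n N) Nn) /= mulrDr.
rewrite -[X in X <= _]add0r lerD //.
  by rewrite mulr_ge0 ?sumr_ge0 // => [|k _]; rewrite ltW.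
rewrite mulr_sumr !big_nat; apply: ler_sum => k /andP[Nk _].
by rewrite mulrC ler_pM2r // Nr.
Unshelve. all: by end_near.
Qed.


Lemma ler_ln_nat (a b : nat) : (0 < a)%N -> (a <= b)%N -> ln (a%:R : R) <= ln b%:R.
Proof.
by move=> a0 ab; rewrite ler_ln ?posrE ?ltr0n ?ler_nat //; apply: leq_trans ab.
Qed.

Lemma ln_natM (a b : nat) : (0 < a)%N -> (0 < b)%N ->
  ln ((a * b)%:R : R) = ln a%:R + ln b%:R.
Proof. by move=> a0 b0; rewrite natrM lnM ?posrE ?ltr0n. Qed.

Lemma ln_natX (a n : nat) : (0 < a)%N -> ln ((a ^ n)%:R : R) = n%:R * ln a%:R.
Proof. by move=> a0; rewrite natrX lnXn ?ltr0n // mulr_natl. Qed.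

Lemma ln_nat_prod (F : nat -> nat) n : (forall k, (0 < F k)%N) ->
  ln ((\prod_(k < n) F k)%N%:R : R) = \sum_(k < n) ln (F k)%:R.
Proof.
move=> F0; elim: n => [|n IH]; first by rewrite !big_ord0 ln1.
by rewrite !big_ord_recr /= ln_natM ?IH // prodn_gt0.
Qed.

Definition lnfact n : R := ln n`!%:R.

Lemma lnfact_ge n : n%:R * ln n%:R <= 2 * lnfact n.
Proof.
case: n => [|n]; first by rewrite mul0r /lnfact ln1 mulr0.
rewrite -ln_natX // /lnfact -(ln_natX 2) ?fact_gt0 //.
by apply: ler_ln_nat; rewrite ?expn_gt0 ?leq_expn_fact_sq.
Qed.

Lemma lnfact_gt0 n : (2 <= n)%N -> 0 < lnfact n.
Proof.
move=> n2; rewrite /lnfact ln_gt0 // ltr1n.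
by apply: leq_trans n2 _; apply: fact_geq.
Qed.

(** The quotient of the factorials costs at most [(n - m) * ln n], which by [lnfact_ge] is at most
    [2 * (1 - m / n)] times [lnfact n]. *)
Lemma lnfact_ratio m n : (0 < m)%N -> (m <= n)%N -> (2 <= n)%N ->
  1 - 2 * (1 - m%:R / n%:R) <= lnfact m / lnfact n <= 1.
Proof.
move=> m0 mn n2; have fn := lnfact_gt0 n2.
have n0 : 0 < n%:R :> R by rewrite ltr0n; apply: leq_trans n2.
have diff : lnfact n <= lnfact m + (n%:R - m%:R) * ln n%:R.
  rewrite -natrB // -ln_natX; last by apply: leq_trans n2.
  rewrite -ln_natM ?fact_gt0 ?expn_gt0 ?(leq_trans m0 mn) //.
  by apply: ler_ln_nat; rewrite ?fact_gt0 ?leq_fact_expn.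
rewrite ler_pdivlMr // ler_pdivrMr // mul1r; apply/andP; split; last first.
  by apply: ler_ln_nat; rewrite ?fact_gt0 ?leq_fact.
have mnR : m%:R <= n%:R :> R by rewrite ler_nat.
have le2 : (n%:R - m%:R) * ln n%:R <= 2 * (1 - m%:R / n%:R) * lnfact n.
  rewrite [leRHS](_ : _ = (1 - m%:R / n%:R) * (2 * lnfact n)); last by ring.
  apply: le_trans (ler_wpM2l _ (lnfact_ge n)).
    by rewrite mulrA [(1 - _) * n%:R]mulrBl mul1r divfK ?gt_eqF.
  by rewrite subr_ge0 ler_pdivrMr ?mul1r.
lra.
Qed.

(** Measures the loss in passing from the symmetric group to Alt, which has index 2. *)
Lemma ln2_lnfact n : (2 <= n)%N -> ln (2 : R) / lnfact n <= 2 / n%:R.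
Proof.
move=> n2; have n0 : 0 < n%:R :> R by rewrite ltr0n; apply: leq_trans n2.
rewrite ler_pdivrMr ?lnfact_gt0 // mulrAC ler_pdivlMr // mulrC.
apply: le_trans (lnfact_ge n); rewrite ler_pM2l //.
exact: (@ler_ln_nat 2).
Qed.


Section LogCount.
Variable m : nat -> nat.
Hypothesis m_ge5 : forall k, (5 <= m k)%N.

Let m_gt0 k : (0 < m k)%N. Proof. exact: leq_trans (m_ge5 k). Qed.
Let m_gt1 k : (2 <= m k)%N. Proof. exact: leq_trans (m_ge5 k). Qed.

(** The logarithm of the number of ways to permute the children of every vertex of level [k]; summed
    in [logsize], it gives the logarithm of the order of the full automorphism group on a level. *)
Definition weight k : R := (\prod_(j < k) m j)%N%:R * lnfact (m k).

Lemma weight_ge k : lnfact 2 <= weight k.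
Proof.
rewrite /weight -[X in X <= _]mul1r; apply: ler_pM => //.
- by rewrite ltW ?lnfact_gt0.
- by rewrite ler1n prodn_gt0.
- by apply: ler_ln_nat; rewrite ?fact_gt0 // leq_fact.
Qed.

Lemma weight_gt0 k : 0 < weight k.
Proof. by apply: lt_le_trans (weight_ge k); apply: lnfact_gt0. Qed.

Definition logsize n : R := \sum_(k < n) weight k.

Lemma logsize_gt0 n : (0 < n)%N -> 0 < logsize n.
Proof.
case: n => // n _; rewrite /logsize big_ord_recr /= ltr_wpDl ?weight_gt0 //.
by apply: sumr_ge0 => k _; apply/ltW/weight_gt0.
Qed.

Lemma ln_prod_expn (A : nat -> nat) n : (forall k, (0 < A k)%N) ->
  ln ((\prod_(k < n) A k ^ (\prod_(j < k) m j))%N%:R : R) =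
  \sum_(k < n) (\prod_(j < k) m j)%N%:R * ln (A k)%:R.
Proof.
move=> A0; rewrite (ln_nat_prod (F := fun k => (A k ^ (\prod_(j < k) m j))%N)).
  by apply: eq_bigr => k _; rewrite ln_natX.
by move=> k; rewrite expn_gt0 A0.
Qed.

Hypothesis m_cvg : (fun k => (m k)%:R^-1 : R) @ \oo --> 0.

(** Halving the factorials multiplies the [k]-th summand by [1 - ln 2 / lnfact (m k)], which tends
    to 1. By [toeplitz] the lower bound is then asymptotic to the upper one. *)
Lemma log_count (A c : nat -> nat) :
    (forall k, (2 * A k = (m k)`!)%N) ->
    (forall n, (\prod_(k < n) A k ^ (\prod_(j < k) m j) <= c n)%N) ->
    (forall n, (c n <= \prod_(k < n) (m k)`! ^ (\prod_(j < k) m j))%N) ->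
  (fun n => ln (c n)%:R / logsize n) @ \oo --> (1 : R).
Proof.
move=> AE Ac cm.
have A0 k : (0 < A k)%N by have := fact_gt0 (m k); rewrite -AE muln_gt0.
have lnA k : ln (A k)%:R = lnfact (m k) * (1 - ln 2 / lnfact (m k)) :> R.
  rewrite mulrBr mulr1 mulrC divfK ?gt_eqF ?lnfact_gt0 //.
  by rewrite /lnfact -AE ln_natM // [RHS]addrC addKr.
have cst1 : (fun _ : nat => 1 : R) @ \oo --> (1 : R) by exact: cvg_cst.
pose r k : R := 1 - ln 2 / lnfact (m k).
have r1 : r @ \oo --> (1 : R).
  have lim1 : (fun k => 1 - 2 * (m k)%:R^-1 : R) @ \oo --> (1 : R).
    rewrite -[X in _ --> X]subr0 -[X in _ - X](mulr0 2).
    by apply: cvgB; [exact: cvg_cst|apply: cvgM => //; exact: cvg_cst].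
  apply: (squeeze_cvgr _ lim1 cst1); near=> k.
  rewrite /r lerD2l lerN2 ln2_lnfact //= gerBl divr_ge0 ?ln_ge0 ?ler1n //.
  exact: fact_gt0.
have T1 := toeplitz (lnfact_gt0 (leqnn 2)) weight_ge r1.
apply: (squeeze_cvgr _ T1 cst1); near=> n.
have n0 : (0 < n)%N by near: n; exact: nbhs_infty_gt.
have S0 := logsize_gt0 n0.
have c0 : (0 < c n)%N.
  by apply: leq_trans (Ac n); rewrite prodn_gt0 // => k; rewrite expn_gt0 A0.
apply/andP; split.
  rewrite ler_pM2r ?invr_gt0 //.
  have -> : \sum_(k < n) weight k * r k =
            \sum_(k < n) (\prod_(j < k) m j)%N%:R * ln (A k)%:R.
    by apply: eq_bigr => k _; rewrite lnA /weight -mulrA.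
  rewrite -ln_prod_expn //; apply: ler_ln_nat => //.
  by rewrite prodn_gt0 // => k; rewrite expn_gt0 A0.
rewrite ler_pdivrMr // mul1r; apply: le_trans (ler_ln_nat c0 (cm n)) _.
by rewrite (@ln_prod_expn (fun k => (m k)`!)%N) // => k; rewrite fact_gt0.
Unshelve. all: by end_near.
Qed.

End LogCount.

(** The quotient is an average, with the weights of [l], of the products of the [m j / l j] for
    [j < k] times [lnfact (m k) / lnfact (l k)]. The last factor tends to 1. *)
Lemma log_ratio (m l : nat -> nat) (x : R) :
    (forall k, (5 <= m k)%N) -> (forall k, (m k <= l k)%N) ->
    (fun k => \prod_(j < k) ((m j)%:R / (l j)%:R) : R) @ \oo --> x ->
    (fun k => (m k)%:R / (l k)%:R : R) @ \oo --> (1 : R) ->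
  (fun n => logsize m n / logsize l n) @ \oo --> x.
Proof.
move=> m5 ml Px ml1.
have l5 k : (5 <= l k)%N by apply: leq_trans (ml k).
have l0 k : (l k)%:R != 0 :> R by rewrite pnatr_eq0; case: (l k) (l5 k).
have cst1 : (fun _ : nat => 1 : R) @ \oo --> (1 : R) by exact: cvg_cst.
pose q k : R := lnfact (m k) / lnfact (l k).
have q1 : q @ \oo --> (1 : R).
  have lim1 : (fun k => 1 - 2 * (1 - (m k)%:R / (l k)%:R) : R) @ \oo --> (1 : R).
    rewrite -[X in _ --> X]subr0 -[X in _ - X](mulr0 2) -[X in 2 * X](subrr 1).
    apply: cvgB; [exact: cvg_cst|apply: cvgM; first exact: cvg_cst].
    by apply: cvgB => //; exact: cvg_cst.
  apply: (squeeze_cvgr _ lim1 cst1); near=> k.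
  by apply: lnfact_ratio => //; [apply: leq_trans (m5 k)|apply: leq_trans (l5 k)].
have rx : (fun k => \prod_(j < k) ((m j)%:R / (l j)%:R) * q k) @ \oo --> x.
  by rewrite -[x]mulr1; apply: cvgM.
have := toeplitz (lnfact_gt0 (leqnn 2)) (weight_ge l5) rx.
apply: cvg_trans; apply: near_eq_cvg; near=> n; congr (_ / _).
apply: eq_bigr => k _; rewrite /weight !natr_prod big_split /= prodfV /q.
have lf0 : lnfact (l k) != 0.
  by rewrite gt_eqF // lnfact_gt0 //; apply: leq_trans (l5 k).
have pl0 : \prod_(j < k) (l j)%:R != 0 :> R by apply/prodf_neq0 => j _.
by field; rewrite lf0.
Unshelve. all: by end_near.
Qed.


Lemma cvg_ratio1 (u : nat -> R) (x : R) : x != 0 -> u @ \oo --> x ->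
  (fun k => u k.+1 / u k) @ \oo --> (1 : R).
Proof.
move=> x0 ux; rewrite -[1](divff x0); apply: cvgM; last exact: cvgV.
by rewrite (cvg_shiftS u).
Qed.

(** * Degrees of a subtree of prescribed density *)

Section SubtreeDegrees.
Variables (l : nat -> nat) (x : R).
Hypothesis l_ge5 : forall k, (5 <= l k)%N.
Hypothesis l_cvg : (fun k => (l k)%:R^-1 : R) @ \oo --> 0.
Hypotheses (x_gt0 : 0 < x) (x_le1 : x <= 1).

(* The least admissible degree keeping the density of the subtree above [x],
   [p] being its density at the current level of degree [d]. *)
Definition next_degree (p : R) (d : nat) : nat :=
  minn d (maxn 5 (Num.truncn (x * d%:R / p)).+1).

Fixpoint density k : R :=
  if k is k'.+1 then density k' * ((next_degree (density k') (l k'))%:R / (l k')%:R)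
  else 1.

Definition degree k := next_degree (density k) (l k).

Lemma degree_le k : (degree k <= l k)%N.
Proof. exact: geq_minl. Qed.

Lemma degree_ge5 k : (5 <= degree k)%N.
Proof. by rewrite leq_min l_ge5 leq_maxl. Qed.

Lemma densityE k : density k = \prod_(j < k) ((degree j)%:R / (l j)%:R).
Proof. by elim: k => [|k IH]; rewrite ?big_ord0 // big_ord_recr /= -IH. Qed.

Let l_gt0 k : 0 < (l k)%:R :> R.
Proof. by rewrite ltr0n; apply: leq_trans (l_ge5 k). Qed.

Lemma density_bounds k : x <= density k <= 1.
Proof.
elim: k => [|k /andP[xp p1]] /=; first by rewrite x_le1 lexx.
have p0 : 0 < density k by apply: lt_le_trans xp.
apply/andP; split; last first.
  rewrite mulr_ile1 ?divr_ge0 ?ler0n ?(ltW p0) // ler_pdivrMr ?mul1r ?ler_nat //.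
  exact: degree_le.
rewrite mulrA ler_pdivlMr //; rewrite /next_degree /minn; case: ifP => [_|_].
  by rewrite ler_pM2r.
rewrite [leRHS]mulrC -ler_pdivrMr //.
have y0 : 0 <= x * (l k)%:R / density k by rewrite divr_ge0 ?mulr_ge0 ?ltW.
have /andP[_ /ltW yle] := truncn_itv y0.
by apply: le_trans yle _; rewrite ler_nat leq_maxr.
Qed.

(** Once [x * l k >= 5] the bound 5 is no constraint, so rounding exceeds the ideal degree by at
    most one child, worth at most [1 / l k] in density. *)
Lemma density_upper k : 5 / x <= (l k)%:R -> density k.+1 <= x + (l k)%:R^-1.
Proof.
move=> lx; have /andP[xp p1] := density_bounds k.
have p0 : 0 < density k by apply: lt_le_trans xp.
have y0 : 0 <= x * (l k)%:R / density k by rewrite divr_ge0 ?mulr_ge0 ?ltW.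
have /andP[yge ylt] := truncn_itv y0.
have t5 : (5 <= (Num.truncn (x * (l k)%:R / density k)).+1)%N.
  rewrite -(ler_nat R); apply: le_trans (ltW ylt).
  rewrite ler_pdivlMr //; apply: (@le_trans _ _ (5 * 1)).
    by rewrite ler_pM2l.
  by rewrite mulr1 mulrC -ler_pdivrMr.
have dle : (next_degree (density k) (l k))%:R <= x * (l k)%:R / density k + 1.
  apply: (@le_trans _ _ (Num.truncn (x * (l k)%:R / density k)).+1%:R).
    by rewrite ler_nat /next_degree (maxn_idPr t5) geq_minr.
  by rewrite -natr1 lerD2r.
rewrite /= mulrA ler_pdivrMr // mulrDl mulVf ?gt_eqF //.
apply: le_trans (ler_wpM2l (ltW p0) dle) _.
rewrite mulrDr mulr1 mulrCA divff ?gt_eqF // mulr1 lerD2l //.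
Qed.

Lemma density_cvg : density @ \oo --> x.
Proof.
rewrite -(cvg_shiftS density).
have lim : (fun k => x + (l k)%:R^-1) @ \oo --> x.
  by rewrite -[X in _ --> X]addr0; apply: cvgD => //; exact: cvg_cst.
have limx : (fun _ : nat => x) @ \oo --> x by exact: cvg_cst.
apply: (squeeze_cvgr _ limx lim); near=> k.
have /andP[-> _] /= := density_bounds k.+1.
apply: density_upper; rewrite -[5 / x]invrK -[leRHS]invrK.
rewrite lef_pV2 ?posrE ?invr_gt0 ?divr_gt0 //.
near: k; have e0 : 0 < (5 / x)^-1 by rewrite invr_gt0 divr_gt0.
have /cvgrPdist_le/(_ _ e0) := l_cvg; apply: filterS => k.
by rewrite sub0r normrN ger0_norm // invr_ge0.
Unshelve. all: by end_near.
Qed.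

Lemma degree_ratio : (fun k => (degree k)%:R / (l k)%:R : R) @ \oo --> (1 : R).
Proof.
have := cvg_ratio1 (lt0r_neq0 x_gt0) density_cvg.
apply: cvg_trans; apply: near_eq_cvg; near=> k => /=.
rewrite mulrAC divff ?mul1r // gt_eqF //.
by have /andP[+ _] := density_bounds k; apply: lt_le_trans.
Unshelve. all: by end_near.
Qed.

End SubtreeDegrees.


(** * Degrees of the ambient tree *)

Section TreeDegrees.
Variable alpha : R.
Hypothesis alpha01 : 0 < alpha < 1.

Let alpha_gt0 : 0 < alpha. Proof. by case/andP: alpha01. Qed.
Let alpha_lt1 : alpha < 1. Proof. by case/andP: alpha01. Qed.

(* The least admissible [d] with [q * (1 - 2 / d) > alpha]. *)
Definition greedy_step (q : R) : nat :=
  maxn 5 (Num.truncn (2 / (1 - alpha / q))).+1.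

Fixpoint greedy_prod k : R :=
  if k is k'.+1
  then greedy_prod k' * (((greedy_step (greedy_prod k'))%:R - 2) /
                         (greedy_step (greedy_prod k'))%:R)
  else 1.

Definition greedy k := greedy_step (greedy_prod k).

Lemma greedy_ge5 k : (5 <= greedy k)%N.
Proof. exact: leq_maxl. Qed.

Lemma greedy_prodE k :
  greedy_prod k = \prod_(j < k) (((greedy j)%:R - 2) / (greedy j)%:R).
Proof. by elim: k => [|k IH]; rewrite ?big_ord0 // big_ord_recr /= -IH. Qed.

(** The gap [q - alpha] drops by [2 * q / d], which is less than the gap by the choice of [d]. It is
    at least 2/5 of the gap: either [d = 5], or minimality of [d] gives
    [d * (q - alpha) <= 2 * q + (q - alpha)]. *)
Lemma greedy_prod_step q (d := greedy_step q) : alpha < q ->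
  0 < q * ((d%:R - 2) / d%:R) - alpha <= 3 / 5 * (q - alpha).
Proof.
move=> aq; have a0 := alpha_gt0; have q0 : 0 < q by apply: lt_trans aq.
have d5 : 5 <= d%:R :> R by rewrite (ler_nat R 5) leq_maxl.
have del0 : 0 < 1 - alpha / q by rewrite subr_gt0 ltr_pdivrMr // mul1r.
have y0 : 0 <= 2 / (1 - alpha / q) by rewrite divr_ge0 // ltW.
have /andP[yge ylt] := truncn_itv y0.
have d0 : 0 < d%:R :> R by lra.
have dgt : 2 / (1 - alpha / q) < d%:R.
  by apply: lt_le_trans ylt _; rewrite ler_nat leq_maxr.
have delq : (1 - alpha / q) * q = q - alpha by rewrite mulrBl mul1r divfK ?gt_eqF.
have -> : q * ((d%:R - 2) / d%:R) - alpha = (q - alpha) - 2 * q / d%:R.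
  by field; rewrite gt_eqF.
have le1 : 2 * q < d%:R * (q - alpha).
  move: dgt; rewrite ltr_pdivrMr // => dgt.
  by rewrite -delq mulrA ltr_pM2r.
apply/andP; split; first by rewrite subr_gt0 ltr_pdivrMr // [ltRHS]mulrC.
suff : 2 / 5 * (q - alpha) <= 2 * q / d%:R by lra.
rewrite ler_pdivlMr //.
case: (leqP 5 (Num.truncn (2 / (1 - alpha / q))).+1) => t5; last first.
  have -> : d = 5%N by rewrite /d /greedy_step (maxn_idPl _) // ltnW.
  by lra.
have dle : d%:R <= 2 / (1 - alpha / q) + 1.
  by rewrite /d /greedy_step (maxn_idPr t5) -natr1 lerD2r.
have dqa : d%:R * (q - alpha) <= 2 * q + (q - alpha).
  rewrite -delq -[X in _ <= X + _](mulfK (lt0r_neq0 del0)).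
  rewrite mulrA; apply: le_trans (ler_wpM2r (ltW q0) (ler_wpM2r (ltW del0) dle)) _.
  rewrite mulrDl mulrDl mul1r divfK ?gt_eqF // lerD2r.
  by rewrite mulrAC divfK ?gt_eqF.
nra.
Qed.

Lemma greedy_prod_gt k : alpha < greedy_prod k.
Proof.
elim: k => //= k IH.
by have /andP[+ _] := greedy_prod_step IH; rewrite subr_gt0.
Qed.

Lemma greedy_prod_cvg : greedy_prod @ \oo --> alpha.
Proof.
have le k : greedy_prod k <= alpha + geometric (1 - alpha) (3 / 5) k.
  rewrite /=; elim: k => [|k IH] /=; first by rewrite expr0; lra.
  have /andP[_] := greedy_prod_step (greedy_prod_gt k).
  rewrite lerBlDl => /le_trans; apply.
  rewrite lerD2l exprS mulrCA ler_pM2l ?divr_gt0 //.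
  by rewrite lerBlDl.
have lim : (fun k => alpha + geometric (1 - alpha) (3 / 5) k) @ \oo --> alpha.
  rewrite -[X in _ --> X]addr0; apply: cvgD; first exact: cvg_cst.
  by apply: cvg_geometric; rewrite ger0_norm ?divr_ge0 // ltr_pdivrMr // mul1r ltr_nat.
have lima : (fun _ : nat => alpha) @ \oo --> alpha by exact: cvg_cst.
apply: (squeeze_cvgr _ lima lim); near=> k.
by rewrite le ltW // greedy_prod_gt.
Unshelve. all: by end_near.
Qed.

(** Consecutive products have quotient [1 - 2 / d], and this tends to 1 because their common limit
    [alpha] is nonzero. *)
Lemma greedy_cvg : (fun k => (greedy k)%:R^-1 : R) @ \oo --> 0.
Proof.
have lim : (fun k => (1 - greedy_prod k.+1 / greedy_prod k) / 2) @ \oo --> (0 : R).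
  rewrite -[X in _ --> X](mul0r 2^-1) -[X in X * _](subrr 1).
  apply: cvgM; last exact: cvg_cst.
  apply: cvgB; first exact: cvg_cst.
  exact: cvg_ratio1 (lt0r_neq0 alpha_gt0) greedy_prod_cvg.
apply: cvg_trans lim; apply: near_eq_cvg; near=> k => /=.
have p0 : greedy_prod k != 0 by rewrite gt_eqF // (lt_trans _ (greedy_prod_gt k)).
have d0 : (greedy_step (greedy_prod k))%:R != 0 :> R.
  by rewrite pnatr_eq0 -lt0n; apply: leq_trans (greedy_ge5 k).
by rewrite /greedy; field; rewrite p0 d0.
Unshelve. all: by end_near.
Qed.

End TreeDegrees.

Lemma tree_degrees (alpha : R) : exists l : nat -> nat,
  [/\ forall k, (5 <= l k)%N, (fun k => (l k)%:R^-1 : R) @ \oo --> 0 &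
      0 < alpha < 1 ->
      (fun k => \prod_(0 <= j < k.+1) (((l j)%:R - 2) / (l j)%:R : R)) @ \oo --> alpha].
Proof.
case: (boolP (0 < alpha < 1)) => [a01|na01].
  exists (greedy alpha); split=> [k||_]; first exact: greedy_ge5.
    exact: greedy_cvg.
  have := greedy_prod_cvg a01; rewrite -(cvg_shiftS (greedy_prod alpha)).
  by apply: cvg_trans; apply: near_eq_cvg; near=> k; rewrite big_mkord -greedy_prodE.
(* Outside the open interval nothing is asked of the products, so degrees growing to infinity
   suffice. *)
exists (fun k => (k + 4).+1); split=> [k||//]; first by lia.
by rewrite (cvg_shiftn 4 (@harmonic R)); exact: cvg_harmonic.
Unshelve. all: by end_near.
Qed.

End Analysis.

(** * The spectrum *)

Section Spectrum.
Variable R : realType.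
Variable l : nat -> nat.
Hypothesis l_ge5 : forall k, (5 <= l k)%N.
Hypothesis l_cvg : (fun k => (l k)%:R^-1 : R) @ \oo --> 0.

Lemma index_log m (le_ml : forall k, (m k <= l k)%N) (H : set (tree_aut l)) :
    (forall k, (5 <= m k)%N) -> (fun k => (m k)%:R^-1 : R) @ \oo --> 0 ->
    subgroup H -> H `<=` biSupported m (l := l) ->
    (forall k, contains_alt le_ml H k) ->
  (fun n => ln (Defs.index H (H `&` level_stabilizer [set: tree_aut l] n))%:R /
    logsize R m n) @ \oo --> (1 : R).
Proof.
move=> m5 mcvg Hgrp Hsupp Halt.
have Tgrp := setT_subgroup l.
have m0 k : (0 < m k)%N by apply: leq_trans (m5 k).
have le n := index_level_le le_ml n Tgrp Hgrp (@subsetT _ H) Hsupp.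
apply: (log_count m5 mcvg (A := fun k => #|('Alt_('I_(m k)))%g|)).
- by move=> k; rewrite card_Alt card_ord //; apply: leq_trans (m5 k).
- by move=> n; apply: (index_level_ge Hgrp m0 Halt Tgrp (@subsetT _ H)); case: (le n).
- by move=> n; case: (le n).
Qed.

Lemma index_log_setT :
  (fun n => ln (Defs.index [set: tree_aut l]
                  (level_stabilizer [set: tree_aut l] n))%:R /
    logsize R l n) @ \oo --> (1 : R).
Proof.
have [H [_ _ _ Halt]] := dense_subgroup (fun k => leqnn (l k)) l_ge5.
under eq_fun do rewrite -[level_stabilizer _ _]setTI.
by apply: (index_log l_ge5 l_cvg (setT_subgroup l) (@biSupportedT l)) => k.
Qed.

Lemma spectrum0 : fg_hausdorff_spectrum [set: tree_aut l] (0 : R).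
Proof.
pose H : set (tree_aut l) := Defs.generated set0.
have H1 : H `<=` [set 1%g].
  apply: generated_sub => //; split; first by rewrite inE.
  by move=> x y; rewrite !inE => -> ->; rewrite mulgV.
exists H; split=> //; [exact: generated_subgroup|by exists set0|].
rewrite /hausdorff_dim.
have lnH n : ln (Defs.index H (H `&` level_stabilizer [set: tree_aut l] n))%:R = 0 :> R.
  have Kgrp : subgroup (H `&` level_stabilizer [set: tree_aut l] n).
    apply: subgroupI; first exact: generated_subgroup.
    exact: level_stabilizer_subgroup (setT_subgroup l).
  have [|_] := index_upper Kgrp (H := H) (phi := fun=> tt).
    by move=> x y /H1-> /H1-> _; rewrite mulVg; apply: subgroup1 Kgrp.
  (* The index is at most 1, and [ln] is 0 at both 0 and 1. *)
  by rewrite card_unit; case: Defs.index => [|[|//]] _; rewrite ?ln1 // ln0.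
under eq_fun do rewrite lnH mul0r.
have lim : (fun _ : nat => (0 : R)%:E) @ \oo --> (0 : R)%:E by exact: cvg_cst.
by rewrite is_cvg_limn_einfE; [apply: cvg_lim|apply: cvgP lim].
Qed.

Lemma spectrum_pos (x : R) : 0 < x <= 1 -> fg_hausdorff_spectrum [set: tree_aut l] x.
Proof.
move=> /andP[x0 x1].
pose m := degree l x.
have m5 : forall k, (5 <= m k)%N by exact: degree_ge5 x l_ge5.
have ml : forall k, (m k <= l k)%N by exact: degree_le l x.
have ratio := degree_ratio l_ge5 l_cvg x0 x1.
have mcvg : (fun k => (m k)%:R^-1 : R) @ \oo --> 0.
  rewrite -[X in _ --> X](mul0r (1^-1 : R)).
  have : (fun k => (l k)%:R^-1 * ((m k)%:R / (l k)%:R)^-1 : R) @ \oo --> (0 * 1^-1 : R).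
    by apply: cvgM => //; apply: cvgV.
  apply: cvg_trans; apply: near_eq_cvg; near=> k.
  by rewrite invf_div mulrA mulVf ?mul1r // pnatr_eq0 -lt0n; apply: leq_trans (l_ge5 k).
have [H [Hgrp Hfg Hsupp Halt]] := dense_subgroup ml m5.
exists H; split=> //.
have logH := index_log m5 mcvg Hgrp Hsupp Halt.
have logG := index_log_setT.
have dens : (fun k => \prod_(j < k) ((m j)%:R / (l j)%:R) : R) @ \oo --> x.
  rewrite (_ : (fun k => _) = density l x); first exact: density_cvg.
  by apply/funext => k; rewrite densityE.
have logml := log_ratio m5 ml dens ratio.
pose i n : R := ln (Defs.index H (H `&` level_stabilizer [set: tree_aut l] n))%:R.
pose j n : R := ln (Defs.index [set: tree_aut l]
                               (level_stabilizer [set: tree_aut l] n))%:R.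
have lim : (fun n => i n / j n) @ \oo --> x.
  (* The quotient factors through [logsize] of [m] and of [l]: the outer factors tend to 1, the
     middle one to [x]. Cancelling needs [n > 0], since [logsize] vanishes at 0. *)
  have : (fun n => i n / logsize R m n * (logsize R m n / logsize R l n) *
      (j n / logsize R l n)^-1) @ \oo --> (1 * x * 1^-1 : R).
    by apply: cvgM; [exact: cvgM|apply: cvgV].
  rewrite invr1 mulr1 mul1r; apply: cvg_trans; apply: near_eq_cvg; near=> n.
  have n0 : (0 < n)%N by near: n; exact: nbhs_infty_gt.
  have sm := lt0r_neq0 (logsize_gt0 R m5 n0).
  have sl := lt0r_neq0 (logsize_gt0 R l_ge5 n0).
  by rewrite invf_div mulrA divfK // mulrA divfK.
have limE : (fun n => (i n / j n)%:E) @ \oo --> x%:E.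
  by apply: cvg_EFin; [apply: nearW|exact: lim].
by rewrite /hausdorff_dim is_cvg_limn_einfE; [apply: cvg_lim limE|apply: cvgP limE].
Unshelve. all: by end_near.
Qed.

End Spectrum.

Unset Implicit Arguments.

Theorem theorem5p9 (R : realType) (alpha : R) (halpha : 0 <= alpha <= 1) :
  exists l : nat -> nat,
    [/\ (forall i : nat, (5 <= l i)%N),
        (0 < alpha < 1 ->
          (fun i : nat => \prod_(0 <= j < i.+1) (((l j)%:R - 2) / (l j)%:R : R))
            @ \oo --> alpha)
      & exists2 G : set (tree_aut l), branch_group G &
          scaled_spectrum_rationals l alpha `|` spectrum_rationals l
            `<=` fg_hausdorff_spectrum G].
Proof.
have [l [l5 lcvg lalpha]] := tree_degrees alpha.
exists l; split=> //; exists [set: tree_aut l]; first exact: branchT.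
have L01 (y : R) : spectrum_rationals l y -> 0 <= y <= 1.
  by move=> [q [q01 _] <-]; rewrite ler0q -(rmorph1 (@ratr R)) ler_rat.
(* Both sets in the union lie in [[0, 1]], so it is enough that the spectrum contains this
   interval. *)
suff spec (y : R) : 0 <= y <= 1 -> fg_hausdorff_spectrum [set: tree_aut l] y.
  move=> y [[z /L01/andP[z0 z1] <-]|/L01]; last exact: spec.
  by apply: spec; case/andP: halpha => a0 a1; rewrite mulr_ge0 // mulr_ile1.
rewrite le_eqVlt => /andP[/predU1P[<- _|y0 y1]]; first exact: spectrum0.
by apply: spectrum_pos; rewrite ?y0.
Qed.
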